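(* Let $M^n$, $n\geq 4$, be a conformally flat Riemannian manifold and let $f\colon M^n\to\mathbb{R}^{n+p}$ be a proper isometric immersion with flat normal bundle. If $f$ carries a principal normal vector field of multiplicity $m\geq 2$, then $p\geq n-m$ and $f$ is quasiumbilical.
   Context: A Riemannian manifold $M^n$ is conformally flat if each point has an open neighborhood conformal to an open subset of $\mathbb{R}^n$. For an isometric immersion $f$ let $\alpha_f\colon TM\times TM\to N_fM$ denote its second fundamental form and, for a normal vector $\xi$, let $A_\xi$ be the shape operator, $\langle A_\xi X,Y\rangle=\langle\alpha_f(X,Y),\xi\rangle$. A normal vector $\eta\in N_fM(x)$ is a principal normal of $f$ at $x$ with multiplicity $s$ if $E_\eta(x)=\{X\in T_xM:\alpha_f(X,Y)=\langle X,Y\rangle\eta\ \text{for all}\ Y\in T_xM\}$ has dimension $s>0$. A principal normal vector field of multiplicity $s$ is a smooth normal vector field $\eta$ with $\dim E_\eta(x)=s>0$ constant. The immersion has flat normal bundle if its normal curvature tensor vanishes at every point; in that case at each $x$ there is a unique finite set of pairwise distinct principal normals, whose subspaces $E_\eta(x)$ give an orthogonal splitting of $T_xM$. An immersion with flat normal bundle is proper if the number of distinct principal normals is constant on $M^n$. An isometric immersion $f\colon M^n\to\mathbb{R}^{n+p}$ is quasiumbilical if at any point of $M^n$ there exists an orthonormal normal base $\xi_1,\dots,\xi_p$ such that each shape operator $A_{\xi_j}$, $1\leq j\leq p$, has an eigenvalue of multiplicity at least $n-1$. *)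

(* Defs.v *)
From HB Require Import structures.
From mathcomp Require Import all_boot all_order all_algebra.
From mathcomp Require Import all_classical all_reals all_analysis.

Set Implicit Arguments.
Unset Strict Implicit.
Unset Printing Implicit Defensive.

Import Order.TTheory GRing.Theory Num.Theory.
Import numFieldNormedType.Exports.

Local Open Scope classical_set_scope.
Local Open Scope ring_scope.
Local Open Scope card_scope.

(* Vectors are rows and matrices act on the right: the Jacobian ['J h y] of
   the library satisfies [X *m 'J h y = 'd h y X]. *)

Section Smooth.
Context {R : realType} {n : nat} {W : normedModType R}.
Implicit Types (U : set 'rV[R]_n) (h : 'rV[R]_n -> W).

(* Class C^k on the set U, which is meant to be open: all iterated partial
   derivatives of order at most k exist and are continuous at the points
   of U. *)
Fixpoint class_C (k : nat) U h : Prop :=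
  (forall y, U y -> {for y, continuous h}) /\
  (if k is k'.+1 then
     forall i : 'I_n, (forall y, U y -> derivable h y (delta_mx 0 i)) /\
                      class_C k' U ('D_(delta_mx 0 i) h)
   else True).

Definition smooth_on U h := forall k, class_C k U h.

End Smooth.

Definition dotmul (R : realType) (N : nat) (u v : 'rV[R]_N) : R :=
  (u *m v^T) 0 0.

(* A homeomorphism [coord] from the open set [dom] of M onto the open set
   [img] of R^n, with inverse [param]; the values of [coord] and [param]
   outside of [dom] and [img] are irrelevant. *)
Record chart (R : realType) (n : nat) (M : topologicalType) := Chart {
  dom : set M ;
  img : set 'rV[R]_n ;
  coord : M -> 'rV[R]_n ;
  param : 'rV[R]_n -> M ;
  chart_dom_open : open dom ;
  chart_img_open : open img ;
  chart_coord_img : forall x, dom x -> img (coord x) ;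
  chart_param_dom : forall y, img y -> dom (param y) ;
  chart_coordK : forall x, dom x -> param (coord x) = x ;
  chart_paramK : forall y, img y -> coord (param y) = y ;
  chart_coord_cont : forall x, dom x -> {for x, continuous coord} ;
  chart_param_cont : forall y, img y -> {for y, continuous param}
}.

Definition smooth_transition (R : realType) (n : nat) (M : topologicalType)
    (c d : chart R n M) : Prop :=
  smooth_on (img c `&` param c @^-1` dom d) (coord d \o param c).

Definition compatible (R : realType) (n : nat) (M : topologicalType)
    (c d : chart R n M) : Prop :=
  smooth_transition c d /\ smooth_transition d c.

(* The atlas is maximal, so that its charts are exactly the diffeomorphisms
   from an open subset of the manifold onto an open subset of R^n. *)
Record manifold (R : realType) (n : nat) := Manifold {
  manifold_space :> topologicalType ;
  atlas : set (chart R n manifold_space) ;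
  manifold_hausdorff : hausdorff_space manifold_space ;
  manifold_second_countable : @second_countable manifold_space ;
  atlas_cover : forall x, exists2 c, atlas c & dom c x ;
  atlas_compatible : forall c d, atlas c -> atlas d -> compatible c d ;
  atlas_maximal : forall c, (forall d, atlas d -> compatible c d) -> atlas c
}.

Section Calculus.
Context {R : realType} {n : nat} {M : manifold R n}.
Implicit Types (c d : chart R n M) (x : M).

Definition chart_at x c := atlas c /\ dom c x.

(* A tangent vector at x is represented, in a chart c at x, by the row of its
   components in the coordinate frame of c; a row also stands for the vector
   field on [dom c] with these constant components. *)

Definition deriv (W : normedModType R) c (X : 'rV[R]_n) (h : M -> W) : M -> W :=
  fun x => 'D_X (h \o param c) (coord c x).

Definition jac (N : nat) c (h : M -> 'rV[R]_N) x : 'M[R]_(n, N) :=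
  'J (h \o param c) (coord c x).

Definition smooth_in_chart (W : normedModType R) c (h : M -> W) : Prop :=
  smooth_on (img c) (h \o param c).

Definition smooth_map (W : normedModType R) (h : M -> W) : Prop :=
  forall c, atlas c -> smooth_in_chart c h.

End Calculus.

(* [gram c x] is the Gram matrix of the metric at x in the coordinate frame
   of c. *)
Record riem_metric (R : realType) (n : nat) (M : manifold R n) := RiemMetric {
  gram : chart R n M -> M -> 'M[R]_n ;
  gram_sym : forall x c, chart_at x c -> (gram c x)^T = gram c x ;
  gram_posdef : forall x c, chart_at x c ->
    forall X : 'rV[R]_n, X != 0 -> 0 < (X *m gram c x *m X^T) 0 0 ;
  gram_change : forall x c d, chart_at x c -> chart_at x d ->
    gram c x = jac c (coord d) x *m gram d x *m (jac c (coord d) x)^T ;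
  gram_smooth : forall c, atlas c -> smooth_in_chart c (gram c)
}.

Section Riemannian.
Context {R : realType} {n : nat} {M : manifold R n}.
Variable g : riem_metric M.

Definition gdot (c : chart R n M) (x : M) (X Y : 'rV[R]_n) : R :=
  (X *m gram g c x *m Y^T) 0 0.

(* h, a diffeomorphism from [dom h] onto [img h], pulls the Euclidean metric
   back to a positive multiple of g at each point. *)
Definition conformal (h : chart R n M) : Prop :=
  forall x, dom h x -> exists2 lambda : R, 0 < lambda &
    forall c, chart_at x c ->
      jac c (coord h) x *m (jac c (coord h) x)^T = lambda *: gram g c x.

Definition conformally_flat : Prop :=
  forall x : M, exists2 h, chart_at x h & conformal h.

End Riemannian.

Section Immersion.
Context {R : realType} {n p : nat} {M : manifold R n}.
Variables (g : riem_metric M) (f : M -> 'rV[R]_(n + p)).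
Implicit Types (c : chart R n M) (x : M) (X Y : 'rV[R]_n)
  (eta xi : 'rV[R]_(n + p)) (sigma : M -> 'rV[R]_(n + p)).

Definition isometric_immersion : Prop :=
  smooth_map f /\
  forall x c, chart_at x c ->
    row_free (jac c f x) /\
    (forall X Y, dotmul (X *m jac c f x) (Y *m jac c f x) = gdot g c x X Y).

Definition normal_at x xi : Prop :=
  forall c, chart_at x c -> forall X, dotmul (X *m jac c f x) xi = 0.

(* Orthogonal projection onto the normal space at x, that is, onto the
   orthogonal complement of the row space of J. *)
Definition normal_proj c x (w : 'rV[R]_(n + p)) : 'rV[R]_(n + p) :=
  let J := jac c f x in w - w *m J^T *m invmx (J *m J^T) *m J.

(* Gauss formula: the normal part of the derivative along X of the field
   f_* Y, where Y is extended with constant components. *)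
Definition sff c x X Y : 'rV[R]_(n + p) :=
  normal_proj c x (deriv c X (deriv c Y f) x).

Definition shape_operator c x xi (A : 'M[R]_n) : Prop :=
  forall X Y, gdot g c x (X *m A) Y = dotmul (sff c x X Y) xi.

Definition normal_connection c X sigma : M -> 'rV[R]_(n + p) :=
  fun x => normal_proj c x (deriv c X sigma x).

(* The term in [X, Y] is absent since X and Y stand for fields with constant
   components, which commute. *)
Definition normal_curvature c X Y sigma x : 'rV[R]_(n + p) :=
  normal_connection c X (normal_connection c Y sigma) x -
  normal_connection c Y (normal_connection c X sigma) x.

Definition flat_normal_bundle : Prop :=
  forall c sigma, atlas c -> smooth_in_chart c sigma ->
    (forall x, dom c x -> normal_at x (sigma x)) ->
    forall X Y x, dom c x -> normal_curvature c X Y sigma x = 0.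

Definition principal_space c x eta : set 'rV[R]_n :=
  [set X | forall Y, sff c x X Y = gdot g c x X Y *: eta].

Definition principal_normal x eta (s : nat) : Prop :=
  [/\ normal_at x eta, (0 < s)%N &
   forall c, chart_at x c -> exists2 E : {vspace 'rV[R]_n},
     principal_space c x eta = [set X | X \in E] & \dim E = s].

Definition principal_normal_field sigma (s : nat) : Prop :=
  smooth_map sigma /\ forall x, principal_normal x (sigma x) s.

Definition proper_immersion : Prop :=
  exists k : nat, forall x : M,
    [set eta | exists s, principal_normal x eta s] #= `I_k.

Definition quasiumbilical : Prop :=
  forall x : M, exists xi : 'I_p -> 'rV[R]_(n + p),
    [/\ forall j, normal_at x (xi j),
        forall i j, dotmul (xi i) (xi j) = (i == j)%:R &
        forall j c, chart_at x c -> exists2 A, shape_operator c x (xi j) A &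
          exists lambda : R, (n - 1 <= \rank (eigenspace A lambda))%N].

End Immersion.

(* Main.v *)
Require Import Defs.
From HB Require Import structures.
From mathcomp Require Import all_boot all_order all_algebra.
From mathcomp Require Import all_classical all_reals all_analysis.
From mathcomp Require Import complex ring lra.

Set Implicit Arguments.
Unset Strict Implicit.
Unset Printing Implicit Defensive.

Import Order.TTheory GRing.Theory Num.Theory.
Import numFieldNormedType.Exports.

Local Open Scope classical_set_scope.
Local Open Scope ring_scope.

(** The conclusion is about one point x, and so is the argument.

    Flat normal bundle makes the shape operators at x commute (the Ricci
    equation), so that the tangent space has a basis of vectors v_i with
    alpha(v_i, Y) = <v_i, Y> eta_i for all Y.  Conformal flatness makes the
    curvature tensor vanish on pairwise orthogonal vectors, which by the Gauss
    equation reads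

      <alpha(X, W), alpha(Y, Z)> = <alpha(X, Z), alpha(Y, W)>

    for X, Y, Z, W pairwise orthogonal.  Let eta be the given principal normal
    and e_1, e_2 orthogonal vectors of E_eta; they exist as m >= 2.  If u and w
    are orthogonal principal vectors with principal normals eta_1 and eta_2
    different from eta, then e_1, e_2, u, w are orthogonal and may be taken of
    unit length, and the quadruple e_1 + u, e_2 + w, e_2 - w, e_1 - u gives

      <eta_1 - eta, eta_2 - eta> = 0                 ([principal_gauss]).

    So the nonzero vectors among the eta_i - eta are pairwise orthogonal in the
    normal space, of dimension p.  There are at least n - m of them, because the
    other v_i lie in E_eta: hence p >= n - m.  Normalize them and complete them
    to an orthonormal basis xi_j of the normal space.  Each xi_j is orthogonal
    to all eta_i - eta but at most one, so all v_i but one are eigenvectors of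
    the shape operator of xi_j for the eigenvalue <eta, xi_j>
    ([principal_normals_quasiumbilical]).

    The Gauss and Ricci equations are needed only in an isothermal chart, that
    is, for a map F from an open subset of R^n to a Euclidean space with
    <F_X, F_Y> = phi <X, Y>, where subscripts denote derivatives along constant
    vectors.  There <F_XY, F_Z> = 0 as soon as X, Y, Z are pairwise orthogonal,
    and this short fact replaces Christoffel symbols and the curvature tensor
    ([isothermal_gauss]).  The Ricci equation follows by differentiating the
    normal field obtained by projecting a fixed vector on the normal spaces
    ([isothermal_ricci]).  The second fundamental form is a tensor
    ([sff_trans]), which carries the result to all charts at x.

    Smoothness is given by iterated partial derivatives.  The calculus part
    turns it into what is used: differentiability, linearity of the derivative
    in its direction, symmetry of second derivatives and closure properties. *)

(** * Mean values along lines, symmetry of second derivatives *)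

Lemma derivable_line (R : realType) (V W : normedModType R) (f : V -> W)
    (a v : V) (t : R) :
  derivable f (a + t *: v) v ->
  is_derive t 1 (fun s : R => f (a + s *: v)) ('D_v f (a + t *: v)).
Proof.
have E : (fun h : R => h^-1 *: (((fun s : R => f (a + s *: v)) \o shift t) (h *: 1)
      - f (a + t *: v))) =
   (fun h : R => h^-1 *: ((f \o shift (a + t *: v)) (h *: v) - f (a + t *: v))).
  apply/funext => h /=; congr (_ *: (f _ - _)).
  by rewrite [h%:A]mulr1 scalerDl addrCA.
by move=> df; split; rewrite /derivable /derive /= E.
Qed.

(** A form without sign condition on s, so that it can be used for
    increments in either direction. *)
Lemma mvt_line (R : realType) (V : normedModType R) (f : V -> R)
    (a v : V) (s : R) :
  (forall t : R, `|t| <= `|s| -> derivable f (a + t *: v) v) ->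
  exists2 c, `|c| <= `|s| & f (a + s *: v) - f a = s * 'D_v f (a + c *: v).
Proof.
move=> df; pose g (t : R) := f (a + t *: v).
have dg (t : R) : `|t| <= `|s| -> is_derive t 1 g ('D_v f (a + t *: v)).
  by move=> /df; exact: derivable_line.
have gc (x y : R) : `|x| <= `|s| -> `|y| <= `|s| -> {within `[x, y], continuous g}.
  move=> xs ys; apply: derivable_within_continuous => t.
  rewrite in_itv /= => /andP[xt ty]; have [] // := dg t.
  by rewrite ler_norml; move: xs ys; rewrite !ler_norml; lra.
have [->|s0] := eqVneq s 0.
  by exists 0; rewrite ?normr0 // scale0r addr0 subrr mul0r.
have Hbd (x y t : R) : `|x| <= `|s| -> `|y| <= `|s| -> t \in `]x, y[ -> `|t| <= `|s|.
  by rewrite in_itv /= !ler_norml => ? ? ?; lra.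
have z0 : `|0 : R| <= `|s| by rewrite normr0.
have [sp|sn] := ltP 0 s.
  have [c cI] := MVT sp (fun x xI => dg x (Hbd 0 s x z0 (lexx _) xI)) (gc 0 s z0 (lexx _)).
  rewrite /g scale0r addr0 subr0 => ->; exists c; last by rewrite mulrC.
  exact: (Hbd 0 s).
have sn' : s < 0 by rewrite lt_neqAle s0.
have [c cI] := MVT sn' (fun x xI => dg x (Hbd s 0 x (lexx _) z0 xI)) (gc s 0 (lexx _) z0).
rewrite /g scale0r addr0 sub0r => E; exists c; first exact: (Hbd s 0).
by rewrite -opprB E mulrN opprK mulrC.
Qed.

(** The second difference of f over the parallelogram spanned by s v and s w is
    s^2 times a mixed derivative at some point of the parallelogram, for either
    order of differentiation; let s tend to 0. *)
Lemma mixed_derivatives (R : realType) (V : normedModType R) (U : set V)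
    (f : V -> R) (v w y : V) :
  open U -> U y ->
  (forall z, U z -> derivable f z v /\ derivable f z w) ->
  (forall z, U z -> derivable ('D_v f) z w /\ derivable ('D_w f) z v) ->
  {for y, continuous ('D_w ('D_v f))} -> {for y, continuous ('D_v ('D_w f))} ->
  'D_w ('D_v f) y = 'D_v ('D_w f) y.
Proof.
move=> oU Uy df ddf c1 c2.
apply/eqP; rewrite -subr_eq0 -normr_le0; apply/ler_addgt0Pr => e e0; rewrite add0r.
have e20 : 0 < e / 2 by lra.
have close (a b c : R) : `|a - c| < e / 2 -> `|b - c| < e / 2 -> `|a - b| <= e.
  by rewrite ltr_norml ler_norml ltr_norml; lra.
have nUy : \forall z \near y, U z by apply: open_nbhs_nbhs.
have /nbhs_ballP[d /= d0 Hd] : \forall z \near y, [/\ U z,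
    `|'D_w ('D_v f) y - 'D_w ('D_v f) z| < e / 2 &
    `|'D_v ('D_w f) y - 'D_v ('D_w f) z| < e / 2].
  move/cvgrPdist_lt: c1 => /(_ _ e20) c1; move/cvgrPdist_lt: c2 => /(_ _ e20) c2.
  apply: (filterS _ (filterI nUy (filterI c1 c2))).
  move=> z [Uz [h1 h2]].
  split; [exact: Uz|exact: h1|exact: h2].
pose s := d / (2 * (`|v| + `|w| + 1)).
have D0 : 0 < `|v| + `|w| + 1 by rewrite ltr_wpDl // addr_ge0.
have s0 : 0 < s by rewrite divr_gt0 // mulr_gt0.
have Hs (a b : R) : `|a| <= `|s| -> `|b| <= `|s| -> ball y d (y + a *: v + b *: w).
  move=> aS bS; rewrite -ball_normE /= -addrA opprD addNKr normrN.
  apply: (@le_lt_trans _ _ (s * (`|v| + `|w|))).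
    rewrite (le_trans (ler_normD _ _))// !normrZ mulrDr.
    by rewrite lerD // ler_wpM2r // -[leRHS]gtr0_norm.
  apply: (@lt_trans _ _ (s * (`|v| + `|w| + 1))); first by rewrite ltr_pM2l // ltrDl.
  by rewrite /s invfM mulrA mulrVK ?unitfE ?gt_eqF // ltr_pdivrMr //; lra.
(* two applications of the mean value theorem to the second difference *)
have key (v' w' : V) :
  (forall a b : R, `|a| <= `|s| -> `|b| <= `|s| -> ball y d (y + a *: v' + b *: w')) ->
  (forall z, U z -> derivable f z v') ->
  (forall z, U z -> derivable ('D_v' f) z w') ->
  exists2 z, ball y d z & f (y + s *: v' + s *: w') - f (y + s *: v')
     - f (y + s *: w') + f y = s * (s * 'D_w' ('D_v' f) z).
  move=> HB dv dvw.
  have z0 : `|0 : R| <= `|s| by rewrite normr0.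
  pose g z := f (z + s *: w') - f z.
  have dg (t : R) : `|t| <= `|s| -> is_derive (y + t *: v') v' g
      ('D_v' f (y + t *: v' + s *: w') - 'D_v' f (y + t *: v')).
    move=> ts; apply: is_deriveB; last first.
      apply: derivableP; apply: dv.
      by have [] := Hd _ (HB t 0 ts z0); rewrite scale0r addr0.
    have E : (fun h : R => h^-1 *: (((fun z => f (z + s *: w')) \o shift (y + t *: v')) (h *: v')
       - f (y + t *: v' + s *: w'))) =
       (fun h : R => h^-1 *: ((f \o shift (y + t *: v' + s *: w')) (h *: v')
         - f (y + t *: v' + s *: w'))).
      by apply/funext => h /=; rewrite !addrA.
    split; rewrite /derivable /derive /= E //.
    by apply: dv; have [] := Hd _ (HB t s ts (lexx _)).
  have [c cs Ec] := @mvt_line _ _ g y v' s (fun t ts => @ex_derive _ _ _ _ _ _ _ (dg t ts)).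
  have [|b bs Eb] := @mvt_line _ _ ('D_v' f) (y + c *: v') w' s.
    by move=> t ts; apply: dvw; have [] := Hd _ (HB c t cs ts).
  exists (y + c *: v' + b *: w'); first exact: HB.
  rewrite -Eb -(@derive_val _ _ _ _ _ _ _ (dg c cs)) -Ec /g.
  by rewrite opprB addrA addrAC.
have [z1 B1 E1] := key v w Hs (fun z Uz => (df z Uz).1) (fun z Uz => (ddf z Uz).1).
have Hs' (a b : R) : `|a| <= `|s| -> `|b| <= `|s| -> ball y d (y + a *: w + b *: v).
  by move=> aS bS; rewrite addrAC; exact: Hs.
have [z2 B2 E2] := key w v Hs' (fun z Uz => (df z Uz).2) (fun z Uz => (ddf z Uz).2).
have E : 'D_w ('D_v f) z1 = 'D_v ('D_w f) z2.
  apply: (mulfI (lt0r_neq0 s0)); apply: (mulfI (lt0r_neq0 s0)).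
  have aux (a b c d' e1 e2 : R) :
    a - b - c + d' = e1 -> a - c - b + d' = e2 -> e1 = e2 by move=> <- <-; ring.
  have Ey : y + s *: w + s *: v = y + s *: v + s *: w by rewrite addrAC.
  rewrite Ey in E2; exact: aux E1 E2.
have [_ H1 _] := Hd _ B1; have [_ _ H2] := Hd _ B2.
rewrite E in H1.
exact: close H1 H2.
Qed.

(** Continuous partial derivatives imply differentiability: going from y to
    y + v along the coordinate axes, each step is by the mean value theorem
    close to v_i times the i-th partial derivative at y. *)
Lemma differentiable_of_partials (R : realType) (n : nat) (U : set 'rV[R]_n)
    (f : 'rV[R]_n -> R) (y : 'rV[R]_n) :
  open U -> U y ->
  (forall i z, U z -> derivable f z (delta_mx 0 i)) ->
  (forall i, {for y, continuous ('D_(delta_mx 0 i) f)}) ->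
  differentiable f y.
Proof.
move=> oU Uy df cf.
pose d (v : 'rV[R]_n) := \sum_(i < n) v 0 i * 'D_(delta_mx 0 i) f y.
have d_lin : linear d.
  move=> a u v; rewrite /d scaler_sumr -big_split; apply: eq_bigr => i _.
  by rewrite !mxE mulrDl -mulrA.
pose dM := GRing.isLinear.Build _ _ _ _ _ d_lin.
pose dL : {linear 'rV[R]_n -> R} := HB.pack d dM.
have d_cont : continuous dL.
  move=> v; apply: differentiable_continuous.
  have -> : (dL : _ -> _) = \sum_(i < n) (fun v : 'rV[R]_n => v 0 i * 'D_(delta_mx 0 i) f y).
    by apply/funext => w; rewrite fct_sumE.
  apply: differentiable_sum => i; apply: differentiableZl.
  exact: differentiable_coord.
have exp : f \o shift y = cst (f y) + (dL : 'rV[R]_n -> R^o) +o_ (0 : 'rV[R]_n) id.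
  apply/eqaddoP => _/posnumP[e].
  have e1 : 0 < e%:num / (n%:R + 1) by rewrite divr_gt0 // ltr_wpDl.
  have nUy : \forall z \near y, U z by apply: open_nbhs_nbhs.
  have /nbhs_ballP[r /= r0 Hr] : \forall z \near y, U z /\ forall i,
     `|'D_(delta_mx 0 i) f y - 'D_(delta_mx 0 i) f z| < e%:num / (n%:R + 1).
    have cf' : \forall z \near y, forall i,
        `|'D_(delta_mx 0 i) f y - 'D_(delta_mx 0 i) f z| < e%:num / (n%:R + 1).
      by apply: (@filter_forall _ _ _ (nbhs y)) => i; move/cvgrPdist_lt : (cf i) => /(_ _ e1).
    near=> z; split; first by near: z; exact: nUy.
    by near: z; exact: cf'.
  rewrite -nbhs_nearE; apply/nbhs_ballP; exists r => //= v.
  rewrite -ball_normE /= sub0r normrN => vr.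
  (* the position after k steps of the walk *)
  pose S k : 'rV[R]_n := \row_(j < n) (if (j < k)%N then v 0 j else 0).
  have vn i : `|v 0 i| <= `|v|.
    by rewrite [leRHS]/Num.Def.normr /= mx_normrE (le_bigmax _ _ (0, i)).
  have SD (k : 'I_n) (c : R) j : (S k + c *: delta_mx 0 k) 0 j =
     if (j < k)%N then v 0 j else if j == k then c else 0.
    rewrite !mxE eqxx /=; case: (eqVneq j k) => [->|jk] /=.
      by rewrite ltnn add0r mulr1.
    by rewrite mulr0 addr0.
  (* the walk stays in the ball since the norm is the largest coordinate *)
  have SB (k : 'I_n) (c : R) : `|c| <= `|v 0 k| -> ball y r (y + (S k + c *: delta_mx 0 k)).
    move=> cv; rewrite -ball_normE /= opprD addNKr normrN.
    apply: le_lt_trans vr; rewrite [leLHS]/Num.Def.normr /= mx_normrE.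
    apply: bigmax_le => // -[i j] _ /=; rewrite ord1 SD.
    by case: ifP => _ //; case: eqP => _; rewrite ?normr0 ?normr_ge0 // (le_trans cv).
  have SS (k : 'I_n) : S k + v 0 k *: delta_mx 0 k = S k.+1.
    apply/rowP => j; rewrite SD !mxE ltnS [(j <= k)%N]leq_eqVlt -val_eqE.
    by case: (ltngtP (j : nat) k) => //= jk; rewrite (val_inj jk : j = k).
  have err (A B C D s x d1 d2 : R) : A - B = x * d2 -> `|B - C - s| <= D ->
      `|x| * `|d1 - d2| <= e%:num / (n%:R + 1) * `|v| ->
      `|A - C - (x * d1 + s)| <= D + e%:num / (n%:R + 1) * `|v|.
    move=> AB H1 H2; have -> : A - C - (x * d1 + s) = (B - C - s) - x * (d1 - d2).
      have -> : A = B + x * d2 by rewrite -AB addrC subrK.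
      ring.
    by rewrite (le_trans (ler_normB _ _)) // lerD // normrM.
  have step k : (k <= n)%N -> `|f (y + S k) - f y
      - \sum_(i < n | (i < k)%N) v 0 i * 'D_(delta_mx 0 i) f y|
      <= k%:R * (e%:num / (n%:R + 1) * `|v|).
    elim: k => [_|k IHk kn].
      rewrite big_pred0 // mul0r subr0.
      have -> : S 0%N = 0 by apply/rowP => j; rewrite !mxE.
      by rewrite addr0 subrr normr0.
    have {}IHk := IHk (ltnW kn); pose ko := Ordinal kn.
    rewrite (bigD1 ko) //= [X in _ - (_ + X)](_ : _ =
       \sum_(i < n | (i < k)%N) v 0 i * 'D_(delta_mx 0 i) f y); last first.
      apply: eq_bigl => i; rewrite ltnS [(i <= k)%N]leq_eqVlt -val_eqE /=.
      by case: ltngtP.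
    set s := \sum_(i < n | _) _ in IHk *.
    have [|c cv Ec] := @mvt_line _ _ f (y + S k) (delta_mx 0 ko) (v 0 ko).
      move=> t tv; apply: df; have B := SB ko t tv; rewrite addrA in B.
      by have [Uz _] := Hr _ B.
    have [_ /(_ ko) Hc] := Hr _ (SB ko c cv).
    have Sk : y + S k + v 0 ko *: delta_mx 0 ko = y + S k.+1 by rewrite -addrA (SS ko).
    rewrite Sk in Ec; rewrite addrA in Hc.
    rewrite -natr1 mulrDl mul1r; apply: (err _ _ _ _ _ _ _ _ Ec IHk).
    by rewrite mulrC ler_pM // ltW.
  have -> : (f \o shift y - (cst (f y) + d)) v = f (y + v) - f y - d v.
    by rewrite -addrA -opprD [y + v]addrC.
  have := step n (leqnn n).
  have -> : S n = v by apply/rowP => j; rewrite !mxE ltn_ord.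
  rewrite (eq_bigl xpredT) => [|i]; last by rewrite ltn_ord.
  move=> /le_trans; apply.
  rewrite mulrA ler_wpM2r // mulrA ler_pdivrMr ?ltr_wpDl //.
  by rewrite mulrC ler_wpM2l // lerDl.
have E := diff_unique d_cont exp.
by apply/diff_locallyP; rewrite E.
Unshelve. all: by end_near. Qed.

(** * Maps of class C^k *)

(** The product rule for a scalar and a vector factor. *)
Lemma is_derive_scale (R : realType) (V W : normedModType R)
    (f : V -> R) (g : V -> W) (x v : V) (df : R) (dg : W) :
  is_derive x v f df -> is_derive x v g dg ->
  is_derive x v (fun y => f y *: g y) (df *: g x + f x *: dg).
Proof.
move=> [f1 <-] [g1 <-].
have aux (k a c : R) (b d : W) :
    k *: (a *: b - c *: d) = (k * (a - c)) *: d + a *: (k *: (b - d)).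
  have -> : (k * (a - c)) *: d = k *: ((a - c) *: d) by rewrite scalerA.
  have -> : a *: (k *: (b - d)) = k *: (a *: (b - d)) by rewrite !scalerA mulrC.
  rewrite -scalerDr; congr (_ *: _).
  by rewrite scalerBl scalerBr [RHS]addrC addrA subrK.
suff H : (fun h => h^-1 *: (((fun y => f y *: g y) \o shift x) (h *: v) - f x *: g x)) @
    0^' --> 'D_v f x *: g x + f x *: 'D_v g x.
  split; last exact: cvg_lim H.
  by apply/cvg_ex; exists ('D_v f x *: g x + f x *: 'D_v g x).
have E : (fun h => h^-1 *: (((fun y => f y *: g y) \o shift x) (h *: v) - f x *: g x)) =
   (fun h => (h^-1 *: ((f \o shift x) (h *: v) - f x)) *: g x) +
   (fun h => (f \o shift x) (h *: v) *: (h^-1 *: ((g \o shift x) (h *: v) - g x))).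
  by apply/funext => h; exact: aux.
rewrite E; apply: cvgD; first exact: cvgZr_tmp f1.
apply: cvgZ; last exact: g1.
suff : {for 0, continuous (fun h : R => f (h *: v + x))}.
  by move=> /continuous_withinNx; rewrite scale0r add0r.
exact/differentiable_continuous/derivable1_diffP/(derivable1P _ _ _).1.
Qed.

Lemma near_eq_on (T : topologicalType) (S : Type) (U : set T) (f g : T -> S) (y : T) :
  open U -> U y -> (forall z, U z -> f z = g z) -> {near y, f =1 g}.
Proof.
move=> oU Uy fg; have nUy : \forall z \near y, U z by exact: open_nbhs_nbhs.
by apply: filterS nUy => z; exact: fg.
Qed.

Lemma near_eq_continuous (T S : topologicalType) (f g : T -> S) (y : T) :
  {near y, f =1 g} -> {for y, continuous f} -> {for y, continuous g}.
Proof.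
move=> fg fc; have fgy : f y = g y := nbhs_singleton fg.
suff: g @ y --> g y by [].
by rewrite -fgy; apply: cvg_trans fc; exact: near_eq_cvg.
Qed.

Section ClassC.
Context {R : realType} {n : nat}.
Implicit Types (U : set 'rV[R]_n).

Local Notation e i := (delta_mx 0 i : 'rV[R]_n).

Section Generic.
Context {W : normedModType R}.
Implicit Types (h g : 'rV[R]_n -> W).

Lemma class_C_cont k U h : class_C k U h -> forall y, U y -> {for y, continuous h}.
Proof. by case: k => [|k] []. Qed.

Lemma class_CW k U h : class_C k.+1 U h -> class_C k U h.
Proof.
elim: k h => [|k IH] h [hc hd]; first by split.
split=> // i; have [h1 h2] := hd i; split=> //; exact: IH.
Qed.

Lemma class_C_le k l U h : (k <= l)%N -> class_C l U h -> class_C k U h.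
Proof.
by move=> /subnK <-; elim: (l - k)%N => // d IH; rewrite addSn => /class_CW.
Qed.

Lemma class_C_ext k U h g : open U -> (forall y, U y -> h y = g y) ->
  class_C k U h -> class_C k U g.
Proof.
move=> oU; elim: k h g => [|k IH] h g hg [hc hd].
  by split=> // y Uy; exact: (near_eq_continuous (near_eq_on oU Uy hg) (hc y Uy)).
split; first by move=> y Uy; exact: (near_eq_continuous (near_eq_on oU Uy hg) (hc y Uy)).
move=> i; have [h1 h2] := hd i; split.
  by move=> y Uy; exact: (near_eq_derivable (near_eq_on oU Uy hg) (h1 y Uy)).
by apply: IH h2 => y Uy; exact: (near_eq_derive _ (near_eq_on oU Uy hg)).
Qed.

Lemma class_C_cst k U (c : W) : open U -> class_C k U (cst c).
Proof.
move=> oU; elim: k c => [|k IH] c; (split; first by move=> y _; exact: cst_continuous) => // i.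
split=> [y Uy|]; first exact: derivable_cst.
by apply: class_C_ext (IH 0) => // y _; rewrite derive_cst.
Qed.

Lemma class_CD k U h g : open U -> class_C k U h -> class_C k U g ->
  class_C k U (h + g).
Proof.
move=> oU; elim: k h g => [|k IH] h g [hc hd] [gc gd].
all: split=> [y Uy|]; first by apply: continuousD; [exact: hc|exact: gc].
  by [].
move=> i; have [h1 h2] := hd i; have [g1 g2] := gd i; split.
  by move=> y Uy; apply: derivableD; [exact: h1|exact: g1].
apply: class_C_ext (IH _ _ h2 g2) => // y Uy.
by rewrite deriveD //; [exact: h1|exact: g1].
Qed.

Lemma class_C_sum k U m (h : 'I_m -> 'rV[R]_n -> W) : open U ->
  (forall i, class_C k U (h i)) -> class_C k U (\sum_(i < m) h i).
Proof.
by move=> oU hh; apply: big_ind => // [|f g]; [exact: class_C_cst|exact: class_CD].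
Qed.

End Generic.

Lemma class_CZ (W : normedModType R) k U (f : 'rV[R]_n -> R) (h : 'rV[R]_n -> W) :
  open U -> class_C k U f -> class_C k U h ->
  class_C k U (fun y => f y *: h y).
Proof.
move=> oU; elim: k f h => [|k IH] f h F H.
  by split=> // y Uy; apply: continuousZ; [exact: class_C_cont F _ _|exact: class_C_cont H _ _].
split=> [y Uy|i].
  by apply: continuousZ; [exact: class_C_cont F _ _|exact: class_C_cont H _ _].
have [_ /(_ i) [f1 f2]] := F; have [_ /(_ i) [h1 h2]] := H.
have D y : U y -> is_derive y (e i) (fun y => f y *: h y)
    ('D_(e i) f y *: h y + f y *: 'D_(e i) h y).
  by move=> Uy; apply: is_derive_scale; apply: derivableP; [exact: f1|exact: h1].
split=> [y Uy|]; first by have [] := D y Uy.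
have C := class_CD oU (IH _ _ f2 (class_CW H)) (IH _ _ (class_CW F) h2).
by apply: class_C_ext C => // y Uy; have [_ ->] := D y Uy.
Qed.

Lemma class_CV k U (f : 'rV[R]_n -> R) : open U -> (forall y, U y -> f y != 0) ->
  class_C k U f -> class_C k U (fun y => (f y)^-1).
Proof.
move=> oU f0; elim: k f f0 => [|k IH] f f0 F.
  by split=> // y Uy; apply: continuousV; [exact: f0|exact: class_C_cont F _ _].
split=> [y Uy|i].
  by apply: continuousV; [exact: f0|exact: class_C_cont F _ _].
have [_ /(_ i) [f1 f2]] := F.
have I := IH f f0 (class_CW F).
split=> [y Uy|]; first by apply: derivableV; [exact: f0|exact: f1].
have C := class_CZ oU (class_C_cst k (-1 : R) oU) (class_CZ oU (class_CZ oU I I) f2).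
apply: class_C_ext C => // y Uy; rewrite deriveV ?f0 //; last exact: f1.
by rewrite /cst /GRing.scale /=; rewrite expr2 invfM !mulN1r mulNr.
Qed.

Section Rows.
Context {N : nat}.
Implicit Types (h g : 'rV[R]_n -> 'rV[R]_N).

Lemma class_C_coord k U h (a : 'I_N) : open U -> class_C k U h ->
  class_C k U (fun y => h y 0 a).
Proof.
move=> oU; have cc (g : 'rV[R]_n -> 'rV[R]_N) y : {for y, continuous g} ->
    {for y, continuous (fun y => g y 0 a)}.
  move=> gc; apply: (@continuous_comp _ _ _ g (fun v : 'rV[R]_N => v 0 a)) => //.
  exact: coord_continuous.
elim: k h => [|k IH] h H.
  by split=> // y Uy; apply: cc; exact: class_C_cont H _ _.
split; first by move=> y Uy; apply: cc; exact: class_C_cont H _ _.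
move=> i; have [_ /(_ i) [h1 h2]] := H; split.
  by move=> y Uy; have /derivable_mxP := h1 y Uy; exact.
by apply: class_C_ext (IH _ h2) => // y Uy; rewrite derive_mx ?mxE //; exact: h1.
Qed.

Lemma class_C_differentiable k U h y : open U -> (0 < k)%N -> class_C k U h -> U y ->
  differentiable h y.
Proof.
case: k => // k oU _ H Uy.
have -> : h = \sum_(a < N) (fun z => h z 0 a *: (delta_mx 0 a : 'rV[R]_N)).
  apply/funext => z; rewrite fct_sumE [LHS](row_sum_delta (h z)) //.
apply: differentiable_sum => a; apply: differentiableZl.
have Ha := class_C_coord a oU H.
apply: (differentiable_of_partials oU Uy) => i; have [_ /(_ i) [h1 h2]] := Ha.
  exact: h1.
exact: class_C_cont h2 _ Uy.
Qed.

Lemma class_C_derivable k U h y v : open U -> (0 < k)%N -> class_C k U h -> U y ->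
  derivable h y v.
Proof. by move=> oU k0 H Uy; apply: diff_derivable; exact: class_C_differentiable H Uy. Qed.

Lemma class_C_deriveE k U h y v : open U -> (0 < k)%N -> class_C k U h -> U y ->
  'D_v h y = v *m 'J h y.
Proof. by move=> oU k0 H Uy; apply: deriveEjacobian; exact: class_C_differentiable H Uy. Qed.

(** The class is defined with the coordinate directions only; the other
    directions follow because the derivative is linear in its direction. *)
Lemma class_C_derive k U h v : open U -> class_C k.+1 U h -> class_C k U ('D_v h).
Proof.
move=> oU H; have [_ Hi] := H.
have C : class_C k U (\sum_(i < n) (fun y => (cst (v 0 i) y : R) *: 'D_(e i) h y)).
  apply: class_C_sum => // i; apply: class_CZ => //; last by have [] := Hi i.
  exact: class_C_cst.
apply: class_C_ext C => // y Uy; rewrite fct_sumE.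
rewrite (class_C_deriveE v oU _ H Uy) // {2}(row_sum_delta v) mulmx_suml.
by apply: eq_bigr => i _; rewrite -scalemxAl -(class_C_deriveE _ oU _ H Uy).
Qed.

Lemma class_C_derive_sym k U h v w y : open U -> (1 < k)%N -> class_C k U h -> U y ->
  'D_v ('D_w h) y = 'D_w ('D_v h) y.
Proof.
move=> oU k1 /(class_C_le k1) H Uy.
have D1 u : class_C 1 U ('D_u h) by exact: class_C_derive.
have D2 u u' : class_C 0 U ('D_u ('D_u' h)) by exact: class_C_derive.
have Dc (g : 'rV[R]_n -> 'rV[R]_N) u z (a : 'I_N) : class_C 1 U g -> U z ->
    'D_u (fun y => g y 0 a) z = 'D_u g z 0 a.
  by move=> G Uz; rewrite derive_mx ?mxE //; exact: class_C_derivable G Uz.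
have Dd (g : 'rV[R]_n -> 'rV[R]_N) u z (a : 'I_N) : class_C 1 U g -> U z ->
    derivable (fun y => g y 0 a) z u.
  by move=> G Uz; exact: ((derivable_mxP _ _ _).1 (class_C_derivable oU (ltn0Sn 0) G Uz)).
apply/rowP => a.
have H1 := class_CW H.
have near1 u z : U z -> {near z, 'D_u (fun y => h y 0 a) =1 (fun y => 'D_u h y 0 a)}.
  move=> Uz; apply: (near_eq_on oU Uz) => t Ut; exact: (Dc h u t a H1 Ut).
have near1' u z : U z -> {near z, (fun y => 'D_u h y 0 a) =1 'D_u (fun y => h y 0 a)}.
  move=> Uz; apply: (near_eq_on oU Uz) => t Ut; exact: esym (Dc h u t a H1 Ut).
have near2 u u' z : U z -> 'D_u' ('D_u (fun y => h y 0 a)) z = 'D_u' ('D_u h) z 0 a.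
  move=> Uz; exact: (etrans (near_eq_derive u' (near1 u z Uz)) (Dc ('D_u h) u' z a (D1 u) Uz)).
apply: (etrans (esym (near2 w v y Uy))); apply: (fun E => etrans E (near2 v w y Uy)).
apply: (mixed_derivatives oU Uy).
- move=> z Uz; split; [exact: (Dd h w z a H1 Uz)|exact: (Dd h v z a H1 Uz)].
- move=> z Uz; split.
    exact: (near_eq_derivable (near1' w z Uz) (Dd ('D_w h) v z a (D1 w) Uz)).
  exact: (near_eq_derivable (near1' v z Uz) (Dd ('D_v h) w z a (D1 v) Uz)).
- have C := class_C_coord a oU (D2 v w).
  apply: near_eq_continuous (class_C_cont C Uy).
  by apply: (near_eq_on oU Uy) => t Ut; exact: esym (near2 w v t Ut).
- have C := class_C_coord a oU (D2 w v).
  apply: near_eq_continuous (class_C_cont C Uy).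
  by apply: (near_eq_on oU Uy) => t Ut; exact: esym (near2 v w t Ut).
Qed.

Lemma dotmulE (u v : 'rV[R]_N) : dotmul u v = \sum_a u 0 a * v 0 a.
Proof. by rewrite /dotmul !mxE; apply: eq_bigr => a _; rewrite !mxE. Qed.

Lemma class_C_dot k U h g : open U -> class_C k U h -> class_C k U g ->
  class_C k U (fun y => dotmul (h y) (g y)).
Proof.
move=> oU H G.
have C : class_C k U (\sum_(a < N) (fun y => h y 0 a *: (g y 0 a : R))).
  by apply: class_C_sum => // a; apply: class_CZ => //; exact: class_C_coord.
by apply: class_C_ext C => // y Uy; rewrite fct_sumE dotmulE.
Qed.

Lemma is_derive_dot h g (y v : 'rV[R]_n) :
  derivable h y v -> derivable g y v ->
  is_derive y v (fun z => dotmul (h z) (g z))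
    (dotmul ('D_v h y) (g y) + dotmul (h y) ('D_v g y)).
Proof.
move=> dh dg.
have -> : (fun z => dotmul (h z) (g z)) = \sum_(a < N) (fun z => h z 0 a *: (g z 0 a : R)).
  by apply/funext => z; rewrite fct_sumE dotmulE.
rewrite !dotmulE -big_split; apply: is_derive_sum => a.
rewrite (derive_mx dh) (derive_mx dg) !mxE; apply: is_derive_scale; apply: derivableP.
  exact: ((derivable_mxP _ _ _).1 dh).
exact: ((derivable_mxP _ _ _).1 dg).
Qed.

End Rows.
End ClassC.

Lemma class_CM (R : realType) (n k : nat) (U : set 'rV[R]_n) (f g : 'rV[R]_n -> R) :
  open U -> class_C k U f -> class_C k U g -> class_C k U (fun y => f y * g y).
Proof. exact: class_CZ. Qed.

Lemma class_C_derivable_scalar (R : realType) (n : nat) (U : set 'rV[R]_n)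
    (f : 'rV[R]_n -> R) (y v : 'rV[R]_n) :
  open U -> class_C 1 U f -> U y -> derivable f y v.
Proof.
move=> oU [_ fi] Uy; apply: diff_derivable; apply: (differentiable_of_partials oU Uy) => i.
  by have [] := fi i.
by have [_ [fc _]] := fi i; exact: fc.
Qed.

(** * The chain rule to second order *)

Section Chain.
Context {R : realType} {n m N : nat}.
Variables (V : set 'rV[R]_n) (U : set 'rV[R]_m).
Variables (T : 'rV[R]_n -> 'rV[R]_m) (F : 'rV[R]_m -> 'rV[R]_N).
Hypothesis oV : open V.
Hypothesis oU : open U.
Hypothesis VU : forall z, V z -> U (T z).

Lemma derive_rowE (G : 'rV[R]_m -> 'rV[R]_N) (v : 'rV[R]_m) y : class_C 1 U G -> U y ->
  'D_v G y = \sum_k v 0 k *: 'D_(delta_mx 0 k) G y.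
Proof.
move=> H Uy; rewrite (class_C_deriveE v oU _ H Uy) // {1}(row_sum_delta v) mulmx_suml.
by apply: eq_bigr => i _; rewrite -scalemxAl -(class_C_deriveE _ oU _ H Uy).
Qed.

Lemma derive_chain (G : 'rV[R]_m -> 'rV[R]_N) X z : class_C 1 V T -> class_C 1 U G -> V z ->
  is_derive z X (G \o T) ('D_('D_X T z) G (T z)).
Proof.
move=> HT HG Vz.
have dT := class_C_differentiable oV (ltn0Sn 0) HT Vz.
have dG := class_C_differentiable oU (ltn0Sn 0) HG (VU Vz).
split; first by apply: diff_derivable; exact: differentiable_comp.
rewrite deriveE; last exact: differentiable_comp.
by rewrite diff_comp //= !deriveE.
Qed.

(** The second term is the tensorial part.  The first one is tangent to F, and
    the normal projection will remove it. *)
Lemma derive_chain2 X Y z : class_C 2 V T -> class_C 2 U F -> V z ->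
  'D_X ('D_Y (F \o T)) z =
  'D_('D_X ('D_Y T) z) F (T z) + 'D_('D_X T z) ('D_('D_Y T z) F) (T z).
Proof.
move=> HT HF Vz; have HT1 := class_CW HT; have HF1 := class_CW HF.
have Uz := VU Vz.
have HTY : class_C 1 V ('D_Y T) by exact: class_C_derive.
have HFk (v : 'rV[R]_m) : class_C 1 U ('D_v F) by exact: class_C_derive.
pose e k : 'rV[R]_m := delta_mx 0 k.
pose H := \sum_k (fun w => 'D_Y T w 0 k *: ('D_(e k) F \o T) w).
(* the first derivative is expanded near z, not only at z *)
have nH : {near z, 'D_Y (F \o T) =1 H}.
  apply: (near_eq_on oV Vz) => w Vw; have [_ E] := derive_chain Y HT1 HF1 Vw.
  apply: etrans E _; apply: etrans (derive_rowE _ HF1 (VU Vw)) _.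
  by rewrite /H fct_sumE.
apply: etrans (near_eq_derive X nH) _.
have dH : is_derive z X H (\sum_k ('D_X ('D_Y T) z 0 k *: 'D_(e k) F (T z)
    + 'D_Y T z 0 k *: 'D_('D_X T z) ('D_(e k) F) (T z))).
  apply: is_derive_sum => k; apply: is_derive_scale.
    2: exact: (derive_chain X HT1 (HFk (e k)) Vz).
  have dTY := class_C_derivable (v := X) oV (ltn0Sn 0) HTY Vz.
  have -> : 'D_X ('D_Y T) z 0 k = 'D_X (fun w => 'D_Y T w 0 k) z.
    by rewrite (derive_mx dTY) mxE.
  by apply: derivableP; exact: ((derivable_mxP _ _ _).1 dTY).
have [_ E] := dH; apply: etrans E _.
rewrite big_split /=; congr (_ + _); first exact: esym (derive_rowE _ HF1 Uz).
set w := 'D_Y T z; set v := 'D_X T z.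
have nw : {near T z, 'D_w F =1 \sum_k (fun y => w 0 k *: 'D_(e k) F y)}.
  by apply: (near_eq_on oU Uz) => y Uy; rewrite fct_sumE; exact: derive_rowE.
apply: esym; apply: etrans (near_eq_derive v nw) _.
have dS : is_derive (T z) v (\sum_k (fun y => w 0 k *: 'D_(e k) F y))
   (\sum_k w 0 k *: 'D_v ('D_(e k) F) (T z)).
  apply: is_derive_sum => k; apply: is_deriveZ; apply: derivableP.
  exact: class_C_derivable oU (ltn0Sn 0) (HFk (e k)) Uz.
by have [_ ->] := dS.
Qed.

End Chain.

(** Linearity in Y needs the symmetry of the second derivative, as the
    definition only gives linearity in the outer direction X. *)
Lemma derive2_expand (R : realType) (n N : nat) (U : set 'rV[R]_n)
    (F : 'rV[R]_n -> 'rV[R]_N) (X Y y : 'rV[R]_n) : open U -> class_C 2 U F -> U y ->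
  'D_X ('D_Y F) y =
  \sum_i \sum_j (X 0 i * Y 0 j) *: 'D_(delta_mx 0 i) ('D_(delta_mx 0 j) F) y.
Proof.
move=> oU HF Uy.
have H1 V : class_C 1 U ('D_V F) by exact: class_C_derive.
apply: etrans (derive_rowE oU X (H1 Y) Uy) _; apply: eq_bigr => i _.
have E : 'D_(delta_mx 0 i) ('D_Y F) y =
    \sum_j Y 0 j *: 'D_(delta_mx 0 i) ('D_(delta_mx 0 j) F) y.
  apply: etrans (class_C_derive_sym _ _ oU (ltnSn 1) HF Uy) _.
  apply: etrans (derive_rowE oU Y (H1 _) Uy) _; apply: eq_bigr => j _.
  exact: (congr1 (fun w => Y 0 j *: w) (class_C_derive_sym _ _ oU (ltnSn 1) HF Uy)).
apply: etrans (congr1 (fun w => X 0 i *: w) E) _.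
by rewrite scaler_sumr; apply: eq_bigr => j _; rewrite scalerA.
Qed.

(** * The Euclidean scalar product and the normal projection *)

Section Dot.
Context {R : realType} {N : nat}.
Implicit Types u v w : 'rV[R]_N.

Lemma dotmulC u v : dotmul u v = dotmul v u.
Proof. by rewrite !dotmulE; apply: eq_bigr => a _; rewrite mulrC. Qed.

Lemma dotmulDl u v w : dotmul (u + v) w = dotmul u w + dotmul v w.
Proof. by rewrite /dotmul mulmxDl mxE. Qed.

Lemma dotmulZl (a : R) u w : dotmul (a *: u) w = a * dotmul u w.
Proof. by rewrite /dotmul -scalemxAl mxE. Qed.

Lemma dotmulNl u w : dotmul (- u) w = - dotmul u w.
Proof. by rewrite /dotmul mulNmx mxE. Qed.

Lemma dotmulDr u v w : dotmul w (u + v) = dotmul w u + dotmul w v.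
Proof. by rewrite dotmulC dotmulDl !(dotmulC w). Qed.

Lemma dotmulZr (a : R) u w : dotmul w (a *: u) = a * dotmul w u.
Proof. by rewrite dotmulC dotmulZl dotmulC. Qed.

Lemma dotmulNr u w : dotmul w (- u) = - dotmul w u.
Proof. by rewrite dotmulC dotmulNl dotmulC. Qed.

Lemma dotmul0l w : dotmul 0 w = 0.
Proof. by rewrite /dotmul mul0mx mxE. Qed.

Lemma dotmul0r w : dotmul w 0 = 0.
Proof. by rewrite dotmulC dotmul0l. Qed.

Lemma dotmul_eq0 u : (dotmul u u == 0) = (u == 0).
Proof.
rewrite dotmulE psumr_eq0 => [|a _]; last by rewrite -expr2 sqr_ge0.
apply/allP/eqP => [u0|-> a _]; last by rewrite mxE mulr0 eqxx.
by apply/rowP => a; have := u0 a (mem_index_enum a); rewrite mulf_eq0 orbb mxE => /eqP.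
Qed.

Lemma dotmul_ge0 u : 0 <= dotmul u u.
Proof. by rewrite dotmulE; apply: sumr_ge0 => a _; rewrite -expr2 sqr_ge0. Qed.

Lemma dotmul_gt0 u : u != 0 -> 0 < dotmul u u.
Proof. by rewrite lt0r dotmul_eq0 dotmul_ge0 andbT. Qed.

Lemma dotmul_inj u v : (forall w, dotmul u w = dotmul v w) -> u = v.
Proof.
move=> E; apply/eqP; rewrite -subr_eq0 -dotmul_eq0.
by rewrite dotmulDl dotmulNl E subrr.
Qed.

(** A vector orthogonal to the orthogonal complement of u and v lies in their
    span.  The vectors u and v may vanish: the quotients below are then 0. *)
Lemma orthogonal_span u v w : dotmul u v = 0 ->
  (forall x, dotmul x u = 0 -> dotmul x v = 0 -> dotmul w x = 0) ->
  exists a b : R, w = a *: u + b *: v.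
Proof.
move=> uv H; pose c x := dotmul w x / dotmul x x.
have cx x : c x * dotmul x x = dotmul w x.
  have [->|x0] := eqVneq x 0; first by rewrite !dotmul0r mulr0.
  by rewrite mulfVK // dotmul_eq0.
exists (c u), (c v); pose x := w - (c u *: u + c v *: v).
have xu : dotmul x u = 0.
  by rewrite dotmulDl dotmulNl dotmulDl !dotmulZl cx (dotmulC v) uv mulr0 addr0 subrr.
have xv : dotmul x v = 0.
  by rewrite dotmulDl dotmulNl dotmulDl !dotmulZl cx uv mulr0 add0r subrr.
apply/eqP; rewrite -subr_eq0 -dotmul_eq0 -/x {1}/x.
by rewrite dotmulDl dotmulNl dotmulDl !dotmulZl !(dotmulC _ x) xu xv !mulr0 addr0 subr0 dotmulC H.
Qed.

End Dot.

Lemma dotmul_mulmx (R : realType) (m N : nat) (A : 'M[R]_(m, N)) (u : 'rV[R]_m)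
    (v : 'rV[R]_N) : dotmul (u *m A) v = dotmul u (v *m A^T).
Proof. by rewrite /dotmul trmx_mul trmxK mulmxA. Qed.

(** The orthogonal projection onto the complement of the row space of J, as a
    matrix acting on the right. *)
Definition normal_mx (R : realType) (n N : nat) (J : 'M[R]_(n, N)) : 'M[R]_N :=
  1%:M - J^T *m invmx (J *m J^T) *m J.

Section NormalProjection.
Context {R : realType} {n N : nat}.
Variable J : 'M[R]_(n, N).
Hypothesis Ju : J *m J^T \in unitmx.

Local Notation P := (normal_mx J).

Lemma normal_mx_sym : P^T = P.
Proof.
rewrite /normal_mx linearB /= trmx1 !trmx_mul trmxK trmx_inv trmx_mul trmxK.
by rewrite mulmxA.
Qed.

Lemma mul_normal_mx : J *m P = 0.
Proof. by rewrite mulmxBr mulmx1 !mulmxA mulmxV // mul1mx subrr. Qed.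

Lemma normal_mx_mul : P *m J^T = 0.
Proof. by rewrite -[P]normal_mx_sym -trmx_mul mul_normal_mx trmx0. Qed.

Lemma normal_mx_id (w : 'rV[R]_N) : w *m J^T = 0 -> w *m P = w.
Proof. by move=> w0; rewrite mulmxBr mulmx1 !mulmxA w0 !mul0mx subr0. Qed.

Lemma normal_mx_idem (w : 'rV[R]_N) : w *m P *m P = w *m P.
Proof. by rewrite normal_mx_id // -mulmxA normal_mx_mul mulmx0. Qed.

Lemma dotmul_normal_mx (u w : 'rV[R]_N) : dotmul (u *m P) w = dotmul u (w *m P).
Proof. by rewrite dotmul_mulmx normal_mx_sym. Qed.

End NormalProjection.

(** The projection only depends on the row space of J.  This is its
    independence of the chart. *)
Lemma normal_mx_unit (R : realType) (n N : nat) (A : 'M[R]_n) (J : 'M[R]_(n, N)) :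
  A \in unitmx -> J *m J^T \in unitmx -> normal_mx (A *m J) = normal_mx J.
Proof.
move=> Au Ju; congr (_ - _).
have Atu : A^T \in unitmx by rewrite unitmx_tr.
have E : A *m J *m (A *m J)^T = A *m (J *m J^T) *m A^T by rewrite trmx_mul !mulmxA.
have Mu : A *m J *m (A *m J)^T \in unitmx by rewrite E !unitmx_mul Au Ju.
have inv : invmx (A *m J *m (A *m J)^T) = invmx A^T *m invmx (J *m J^T) *m invmx A.
  have MI : A *m J *m (A *m J)^T *m (invmx A^T *m invmx (J *m J^T) *m invmx A) = 1%:M.
    by rewrite E !mulmxA (mulmxK Atu) -(mulmxA A J) (mulmxK Ju) mulmxV.
  by rewrite -[RHS](mulKmx Mu) MI mulmx1.
rewrite inv trmx_mul !mulmxA (mulmxK Atu).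
by rewrite mulmxKV.
Qed.

(** * Isothermal immersions of an open subset of R^n *)

Section Isothermal.
Context {R : realType} {n N : nat}.
Variables (U : set 'rV[R]_n) (F : 'rV[R]_n -> 'rV[R]_N) (phi : 'rV[R]_n -> R).
Hypothesis oU : open U.
Hypothesis F_smooth : smooth_on U F.
Hypothesis phi_gt0 : forall y, U y -> 0 < phi y.
Hypothesis F_conf : forall y X Y, U y ->
  dotmul ('D_X F y) ('D_Y F y) = phi y * dotmul X Y.

Local Notation J y := ('J F y).
Local Notation P y := (normal_mx ('J F y)).
Local Notation alpha X Y y := ('D_X ('D_Y F) y *m normal_mx ('J F y)).
Local Notation e i := (delta_mx 0 i : 'rV[R]_n).

Let smooth1 k X : class_C k U ('D_X F).
Proof. exact: class_C_derive. Qed.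

Let smooth2 k X Y : class_C k U ('D_X ('D_Y F)).
Proof. exact: class_C_derive. Qed.

Let deriveFE X y : U y -> 'D_X F y = X *m J y.
Proof. by move=> Uy; exact: (class_C_deriveE X oU (ltn0Sn 0) (F_smooth 1) Uy). Qed.

Let derivable1 X Y y : U y -> derivable ('D_X F) y Y.
Proof. by move=> Uy; exact: (class_C_derivable oU (ltn0Sn 0) (smooth1 1 X) Uy). Qed.

Let derivable2 X Y Z y : U y -> derivable ('D_X ('D_Y F)) y Z.
Proof. by move=> Uy; exact: (class_C_derivable oU (ltn0Sn 0) (smooth2 1 X Y) Uy). Qed.

Lemma isothermal_gram y : U y -> J y *m (J y)^T = (phi y)%:M.
Proof.
move=> Uy; apply/row_matrixP => i; apply: dotmul_inj => w.
by rewrite !rowE mulmxA dotmul_mulmx trmxK -!deriveFE // F_conf // mul_mx_scalar dotmulZl.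
Qed.

Lemma isothermal_unit y : U y -> J y *m (J y)^T \in unitmx.
Proof.
move=> Uy; rewrite isothermal_gram // unitmxE det_scalar unitrX ?unitfE ?gt_eqF //.
exact: phi_gt0.
Qed.

Lemma second_derivative_sym X Y y : U y -> 'D_X ('D_Y F) y = 'D_Y ('D_X F) y.
Proof. by move=> Uy; exact: (class_C_derive_sym X Y oU (ltnSn 1) (F_smooth 2) Uy). Qed.

Lemma derive_dot_cst0 (h g : 'rV[R]_n -> 'rV[R]_N) X y :
  U y -> derivable h y X -> derivable g y X ->
  (forall z, U z -> dotmul (h z) (g z) = 0) ->
  dotmul ('D_X h y) (g y) + dotmul (h y) ('D_X g y) = 0.
Proof.
move=> Uy dh dg hg; have [_ <-] := is_derive_dot dh dg.
have nhg : {near y, (fun z => dotmul (h z) (g z)) =1 cst 0} by exact: near_eq_on Uy hg.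
by rewrite (near_eq_derive _ nhg) derive_cst.
Qed.

(** Write H(A, B, C) for <F_AB, F_C>.  Differentiating <F_B, F_C> = 0 along A
    shows that H changes sign when B and C are exchanged, and H is symmetric in
    A and B: these two symmetries force H = 0. *)
Lemma isothermal_triple X Y Z y : U y ->
  dotmul X Y = 0 -> dotmul X Z = 0 -> dotmul Y Z = 0 ->
  dotmul ('D_X ('D_Y F) y) ('D_Z F y) = 0.
Proof.
move=> Uy XY XZ YZ.
have K (H : 'rV[R]_n -> 'rV[R]_n -> 'rV[R]_n -> R) : (forall A B C, H A B C = H B A C) ->
    H X Y Z + H X Z Y = 0 -> H Y X Z + H Y Z X = 0 -> H Z X Y + H Z Y X = 0 ->
    H X Y Z = 0.
  by move=> HS; rewrite (HS Y X) (HS Z X) (HS Z Y); lra.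
have key (A B C : 'rV[R]_n) : dotmul B C = 0 ->
    dotmul ('D_A ('D_B F) y) ('D_C F y) + dotmul ('D_A ('D_C F) y) ('D_B F y) = 0.
  move=> BC; rewrite [X in _ + X]dotmulC; apply: derive_dot_cst0 => //.
  - exact: derivable1.
  - exact: derivable1.
  - by move=> z Uz; rewrite F_conf // BC mulr0.
have k1 := key X Y Z YZ.
have k2 := key Y X Z XZ.
have k3 := key Z X Y XY.
apply: (K (fun A B C => dotmul ('D_A ('D_B F) y) ('D_C F y)) _ k1 k2 k3) => A B C.
exact: (congr1 (fun v => dotmul v ('D_C F y)) (second_derivative_sym A B Uy)).
Qed.

(** The Gauss equation where the curvature of a conformally flat metric
    vanishes.  Differentiate <F_X, F_ZY> = 0 along W and <F_X, F_WY> = 0 along Z: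
    the third derivatives agree, so <F_WX, F_ZY> = <F_ZX, F_WY>.  The second
    derivatives may be replaced by their normal parts, because by
    [isothermal_triple] the tangent parts of F_AB and F_CD are in the spans of
    F_A, F_B and of F_C, F_D, which are orthogonal. *)
Lemma isothermal_gauss X Y Z W y : U y ->
  dotmul X Y = 0 -> dotmul X Z = 0 -> dotmul X W = 0 ->
  dotmul Y Z = 0 -> dotmul Y W = 0 -> dotmul Z W = 0 ->
  dotmul (alpha X W y) (alpha Y Z y) = dotmul (alpha X Z y) (alpha Y W y).
Proof.
move=> Uy XY XZ XW YZ YW ZW.
(* tangent parts of second derivatives do not contribute *)
have flat A B C D : dotmul A B = 0 -> dotmul A C = 0 -> dotmul A D = 0 ->
   dotmul B C = 0 -> dotmul B D = 0 -> dotmul C D = 0 ->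
   dotmul (alpha A B y) (alpha C D y) = dotmul ('D_A ('D_B F) y) ('D_C ('D_D F) y).
  move=> AB AC AD BC BD CD.
  have T1 : exists a b, 'D_A ('D_B F) y *m (J y)^T = a *: A + b *: B.
    apply: orthogonal_span => // V VA VB.
    rewrite dotmul_mulmx trmxK -deriveFE // isothermal_triple // dotmulC //.
  have T2 : exists a b, 'D_C ('D_D F) y *m (J y)^T = a *: C + b *: D.
    apply: orthogonal_span => // V VA VB.
    rewrite dotmul_mulmx trmxK -deriveFE // isothermal_triple // dotmulC //.
  have [a [b E1]] := T1; have [c [d E2]] := T2.
  rewrite dotmul_normal_mx normal_mx_idem ?isothermal_unit // mulmxBr mulmx1.
  rewrite dotmulDr dotmulNr isothermal_gram // invmx_scalar !mulmxA E2.
  rewrite mul_mx_scalar -scalemxAl dotmulZr [X in _ * X]dotmulC dotmul_mulmx E1.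
  rewrite !(dotmulDl, dotmulDr, dotmulZl, dotmulZr) !(dotmulC C) !(dotmulC D) AC BC AD BD.
  by rewrite !(mulr0, addr0) subr0.
have osym (A B : 'rV[R]_n) : dotmul A B = 0 -> dotmul B A = 0 by rewrite dotmulC.
apply: etrans (flat X W Y Z XW XY XZ (osym _ _ YW) (osym _ _ ZW) YZ) _.
apply: (fun E => etrans E (esym (flat X Z Y W XZ XY XW (osym _ _ YZ) ZW YW))).
(* differentiation of the triple identity, producing third derivatives *)
have third A B C D : dotmul A B = 0 -> dotmul A C = 0 -> dotmul B C = 0 ->
   dotmul ('D_D ('D_A F) y) ('D_B ('D_C F) y) + dotmul ('D_A F y) ('D_D ('D_B ('D_C F)) y) = 0.
  move=> AB AC BC; apply: derive_dot_cst0 => //; first exact: derivable1.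
    exact: derivable2.
  by move=> z Uz; rewrite dotmulC isothermal_triple // dotmulC.
have k1 := third X Z Y W XZ XY (osym _ _ YZ).
have k2 := third X W Y Z XW XY (osym _ _ YW).
have mix : 'D_W ('D_Z ('D_Y F)) y = 'D_Z ('D_W ('D_Y F)) y.
  exact: (class_C_derive_sym W Z oU (ltnSn 1) (smooth1 2 Y) Uy).
have mid (a b c c' : R) : a + c = 0 -> b + c' = 0 -> c = c' -> a = b.
  by move=> ac + cc; rewrite -cc -ac => /addIr.
apply: etrans (congr2 (@dotmul R N) (second_derivative_sym X W Uy)
  (second_derivative_sym Y Z Uy)) _.
apply: etrans (mid _ _ _ _ k1 k2 (congr1 (dotmul _) mix)) _.
exact: (congr2 (@dotmul R N) (second_derivative_sym Z X Uy) (second_derivative_sym W Y Uy)).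
Qed.

(** The factor is the squared length of a coordinate vector field. *)
Lemma isothermal_factor_smooth k : (0 < n)%N -> class_C k U phi.
Proof.
move=> n0; pose i := Ordinal n0.
have C := class_C_dot oU (smooth1 k (e i)) (smooth1 k (e i)).
apply: class_C_ext C => // y Uy; rewrite F_conf // dotmulE (bigD1 i) //= big1 => [|j ji].
  by rewrite !mxE !eqxx addr0 !mulr1.
by rewrite !mxE (negPf ji) andbF mulr0.
Qed.

Lemma isothermal_projE w y : U y -> w *m P y =
  w - \sum_k ((phi y)^-1 * dotmul w ('D_(e k) F y)) *: 'D_(e k) F y.
Proof.
move=> Uy; rewrite mulmxBr mulmx1 isothermal_gram // invmx_scalar !mulmxA.
congr (_ - _); rewrite mul_mx_scalar -scalemxAl.
rewrite (row_sum_delta (w *m (J y)^T)) mulmx_suml scaler_sumr; apply: eq_bigr => k _.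
rewrite -scalemxAl -deriveFE // scalerA; congr (_ * _ *: _).
rewrite deriveFE // [RHS]dotmulC dotmul_mulmx dotmulE (bigD1 k) //= big1 => [|j jk].
  by rewrite !mxE !eqxx mul1r addr0.
by rewrite !mxE (negPf jk) andbF mul0r.
Qed.

(** Let s be the projection of the fixed vector xi on the normal spaces.  From
    <s, F_k> = 0 one gets <s_Y, F_k> = - <s, F_Yk>, so the normal part of s_Y is
    s_Y + phi^-1 sum_k <s, F_Yk> F_k.  Differentiate along X and project: the
    terms along F_k disappear, and what remains is the normal part of s_XY plus
    phi^-1 sum_k <s, F_Yk> alpha(X, e_k).  Flatness and the symmetry of s_XY give
    the symmetry of the sum in X and Y. *)
Lemma isothermal_ricci : (0 < n)%N ->
  (forall s, smooth_on U s ->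
    (forall z X, U z -> dotmul ('D_X F z) (s z) = 0) ->
    forall X Y y, U y ->
      'D_X (fun z => 'D_Y s z *m P z) y *m P y = 'D_Y (fun z => 'D_X s z *m P z) y *m P y) ->
  forall y X Y xi, U y ->
  \sum_k dotmul xi (alpha Y (e k) y) *: alpha X (e k) y =
  \sum_k dotmul xi (alpha X (e k) y) *: alpha Y (e k) y.
Proof.
move=> n0 flat y X Y xi Uy.
have phi0 z : U z -> phi z != 0 by move=> Uz; rewrite gt_eqF // phi_gt0.
have phiV k : class_C k U (fun z => (phi z)^-1).
  by apply: class_CV => //; exact: isothermal_factor_smooth.
(* the normal part of xi, written so that its smoothness is visible *)
pose s : 'rV[R]_n -> 'rV[R]_N := cst xi + \sum_k (fun z =>
  (-1 * ((phi z)^-1 * dotmul xi ('D_(e k) F z))) *: 'D_(e k) F z).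
have sE z : U z -> s z = xi *m P z.
  move=> Uz; rewrite isothermal_projE // [LHS]/(_ + _) fct_sumE -sumrN.
  by congr (_ + _); apply: eq_bigr => k _; rewrite mulN1r scaleNr.
have s_smooth : smooth_on U s.
  move=> k; apply: class_CD => //; first exact: class_C_cst.
  apply: class_C_sum => // i; apply: class_CZ => //.
  apply: class_CM => //; first exact: class_C_cst.
  apply: class_CM => //; apply: class_C_dot => //; exact: class_C_cst.
have s_normal z V : U z -> dotmul ('D_V F z) (s z) = 0.
  move=> Uz; rewrite sE // deriveFE // dotmul_mulmx -mulmxA normal_mx_mul ?isothermal_unit //.
  by rewrite mulmx0 dotmul0r.
have s1 V k : class_C k U ('D_V s) by exact: class_C_derive.
pose c V k z : R := (phi z)^-1 * dotmul (s z) ('D_V ('D_(e k) F) z).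
have c_smooth V k l : class_C l U (c V k).
  apply: class_CM => //; apply: class_C_dot => //; exact: smooth2.
pose tau V := 'D_V s + \sum_k (fun z => c V k z *: 'D_(e k) F z).
have tauE V z : U z -> 'D_V s z *m P z = tau V z.
  move=> Uz; rewrite isothermal_projE // [RHS]/(_ + _) fct_sumE -sumrN; congr (_ + _).
  apply: eq_bigr => k _; rewrite -scaleNr -mulrN; congr (_ * _ *: _).
  have := derive_dot_cst0 Uz (class_C_derivable oU (ltn0Sn 0) (s_smooth 1) Uz)
    (@derivable1 (e k) V z Uz) (fun z Uz => etrans (dotmulC _ _) (s_normal z (e k) Uz)).
  by move/eqP; rewrite addr_eq0 => /eqP ->; rewrite opprK.
have tauP V W : 'D_W (tau V) y *m P y =
    'D_W ('D_V s) y *m P y + \sum_k c V k y *: alpha W (e k) y.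
  have dtau : is_derive y W (tau V) ('D_W ('D_V s) y
      + \sum_k ('D_W (c V k) y *: 'D_(e k) F y + c V k y *: 'D_W ('D_(e k) F) y)).
    apply: is_deriveD.
      by apply: derivableP; exact: (class_C_derivable oU (ltn0Sn 0) (s1 V 1) Uy).
    apply: is_derive_sum => k; apply: is_derive_scale; apply: derivableP; last exact: derivable1.
    exact: class_C_derivable_scalar (c_smooth V k 1) Uy.
  have [_ ->] := dtau; rewrite mulmxDl mulmx_suml; congr (_ + _); apply: eq_bigr => k _.
  rewrite mulmxDl -!scalemxAl (deriveFE (e k) Uy) -(mulmxA _ (J y)).
  rewrite mul_normal_mx ?isothermal_unit //.
  by rewrite mulmx0 scaler0 add0r.
have H := flat s s_smooth s_normal X Y y Uy.
have nY : {near y, (fun z => 'D_Y s z *m P z) =1 tau Y} by apply: near_eq_on oU Uy (tauE Y).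
have nX : {near y, (fun z => 'D_X s z *m P z) =1 tau X} by apply: near_eq_on oU Uy (tauE X).
have mix : 'D_X ('D_Y s) y = 'D_Y ('D_X s) y.
  exact: (class_C_derive_sym X Y oU (ltnSn 1) (s_smooth 2) Uy).
have cancel (a a' b b' : 'rV[R]_N) : a + b = a' + b' -> a = a' -> b = b'.
  by move=> H1 H2; apply: (@addrI _ a); rewrite H1 H2.
pose mulP (v : 'rV[R]_N) := v *m P y.
have E1 : mulP ('D_X (fun z => 'D_Y s z *m P z) y) = mulP ('D_X (tau Y) y).
  exact: congr1 (near_eq_derive X nY).
have E2 : mulP ('D_Y (fun z => 'D_X s z *m P z) y) = mulP ('D_Y (tau X) y).
  exact: congr1 (near_eq_derive Y nX).
have H1 : mulP ('D_X (tau Y) y) = mulP ('D_Y (tau X) y) := etrans (esym E1) (etrans H E2).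
have {H1}H := cancel _ _ _ _ (etrans (esym (tauP Y X)) (etrans H1 (tauP X Y))) (congr1 mulP mix).
have cE V k : dotmul xi (alpha V (e k) y) = phi y * c V k y.
  rewrite /c mulrA (mulfV (phi0 y Uy)) mul1r (sE y Uy).
  exact: esym (dotmul_normal_mx _ xi _).
have K V W : \sum_k dotmul xi (alpha V (e k) y) *: alpha W (e k) y =
    phi y *: (\sum_k c V k y *: alpha W (e k) y).
  by rewrite scaler_sumr; apply: eq_bigr => k _; rewrite cE scalerA.
exact: (etrans (K Y X) (etrans (congr1 (fun v => phi y *: v) H) (esym (K X Y)))).
Qed.

End Isothermal.

(** * Simultaneous diagonalization and orthonormal completion *)

Section Spectral.
Context {R : rcfType} {n : nat}.
Implicit Types A : 'M[R]_n.

Local Notation C := (map_mx (real_complex R)).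

(** Over R[i] the matrix is normal with real eigenvalues, and similarity
    between real matrices descends from R[i] to R. *)
Lemma symmetric_diagonalizable A : A^T = A -> diagonalizable A.
Proof.
move=> Asym.
have Creal B : C B \is a (@mxOver n n _ (Num.real : {pred R[i]})).
  by apply/mxOverP => i j; rewrite mxE complex_real.
have Csym : C A \is symmetricmx.
  apply/is_hermitianmxP; rewrite expr0 scale1r; apply/matrixP => i j.
  by rewrite !mxE -{1}Asym mxE.
have Ch := realsym_hermsym Csym (Creal A).
have /orthomx_spectralP := hermitian_normalmx Ch.
set P := spectralmx _; set d := spectral_diag _ => Ad.
have Pu : P \in unitmx := spectral_unit _.
have dreal : d \is a (@mxOver 1 n _ (Num.real : {pred R[i]})).
  exact: hermitian_spectral_diag_real.
have Dreal : diag_mx d \is a (@mxOver n n _ (Num.real : {pred R[i]})).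
  apply/mxOverP => i j; rewrite mxE rpredMn //; exact: (mxOverP dreal).
have sim : similar_in unitmx (C A) (diag_mx d).
  exists P => //; apply/similarP => //.
  by rewrite Ad !mulmxA mulmxV // mul1mx.
have [Q /andP[Qr Qu] /(similarP Qu) QA] := real_similar sim (Creal A) Dreal.
have QE : Q = C (map_mx (@complex.Re R) Q).
  by apply/matrixP => i j; rewrite !mxE RRe_real // (mxOverP Qr).
have dE : d = map_mx (real_complex R) (map_mx (@complex.Re R) d).
  by apply/matrixP => i j; rewrite !mxE RRe_real // (mxOverP dreal).
have Qu' : map_mx (@complex.Re R) Q \in unitmx by rewrite -(map_unitmx (real_complex R)) -QE.
exists (map_mx (@complex.Re R) Q) => //; apply/diagonalizable_forPex.
exists (map_mx (@complex.Re R) d); apply/(simmxP Qu').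
apply: (map_mx_inj (f := real_complex R)).
by rewrite !map_mxM /= map_diag_mx -QE -dE.
Qed.

Lemma symmetric_codiagonalizable (As : seq 'M[R]_n) :
  {in As, forall A, A^T = A} -> {in As &, forall A B, A *m B = B *m A} ->
  exists2 P : 'M[R]_n, P \in unitmx &
    forall A, A \in As -> exists d, P *m A = diag_mx d *m P.
Proof.
move=> sym com.
have [P Pu /allP PA] : codiagonalizable As.
  by apply/codiagonalizableP; split => // A /sym; exact: symmetric_diagonalizable.
exists P => // A /PA /= /diagonalizable_forPex [d /(simmxP Pu) E].
by exists d.
Qed.

End Spectral.

(** The rows of J and Q together are linearly independent. *)
Lemma orthonormal_size (R : realType) (n p k : nat) (J : 'M[R]_(n, n + p))
    (Q : 'M[R]_(k, n + p)) : row_free J ->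
  Q *m Q^T = 1%:M -> Q *m J^T = 0 -> (k <= p)%N.
Proof.
move=> Jfree QQ QJ.
have JQ : J *m Q^T = 0 by rewrite -[J]trmxK -trmx_mul QJ trmx0.
have : row_free (col_mx J Q).
  apply: inj_row_free => v; rewrite -[v]hsubmxK mul_row_col => v0.
  have r0 : rsubmx v = 0.
    by move/(congr1 (mulmx^~ Q^T)): v0; rewrite mulmxDl -!mulmxA JQ QQ mulmx1 mulmx0 add0r mul0mx.
  move: v0; rewrite r0 mul0mx addr0 => /eqP; rewrite mulmx_free_eq0 // => /eqP ->.
  by rewrite row_mx0.
by rewrite /row_free => /eqP E; have := rank_leq_col (col_mx J Q); rewrite E leq_add2l.
Qed.

(** The rows of Q become the first rows of Q'; only their orthogonality to
    the other rows is recorded.  While there are fewer than p of them, a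
    dimension count gives a nonzero vector orthogonal to all rows of J and Q. *)
Lemma orthonormal_extension (R : realType) (n p k : nat) (J : 'M[R]_(n, n + p))
    (Q : 'M[R]_(k, n + p)) : row_free J ->
  Q *m Q^T = 1%:M -> Q *m J^T = 0 ->
  exists Q' : 'M[R]_(p, n + p),
    [/\ Q' *m Q'^T = 1%:M, Q' *m J^T = 0 &
     forall (i : 'I_k) (j : 'I_p), i != j :> nat -> (Q *m Q'^T) i j = 0].
Proof.
move=> Jfree; have [d kd] : exists d, (p <= k + d)%N by exists p; rewrite leq_addl.
elim: d k Q kd => [|d IH] k Q kd QQ QJ; have kp := orthonormal_size Jfree QQ QJ.
  have kE : k = p by apply/eqP; rewrite eqn_leq kp -[k]addn0 kd.
  subst k; exists Q; split=> // i j ij.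
  by rewrite QQ mxE -val_eqE (negPf ij).
have [pk|kp'] := leqP p k; first by apply: IH => //; rewrite (leq_trans pk) // leq_addr.
pose K := kermx (col_mx J Q)^T.
have : K != 0.
  rewrite kermx_eq0 /row_free; apply/negP => /eqP E.
  have := rank_leq_col (col_mx J Q)^T; rewrite E leq_add2l leqNgt.
  by rewrite kp'.
move=> /rowV0Pn [v /sub_kermxP vK v0].
have [vJ vQ] : v *m J^T = 0 /\ v *m Q^T = 0.
  by move: vK; rewrite tr_col_mx mul_mx_row -row_mx0 => /eq_row_mx.
have vv := dotmul_gt0 v0.
pose w := (Num.sqrt (dotmul v v))^-1 *: v.
have ww : w *m w^T = 1%:M.
  apply/matrixP => i j; rewrite !ord1 -[LHS]/(dotmul w w) dotmulZl dotmulZr mxE eqxx.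
  by rewrite mulrA -invfM -expr2 sqr_sqrtr ?ltW // mulVf // gt_eqF.
have wJ : w *m J^T = 0 by rewrite -scalemxAl vJ scaler0.
have wQ : w *m Q^T = 0 by rewrite -scalemxAl vQ scaler0.
have Qw : Q *m w^T = 0 by rewrite -[Q]trmxK -trmx_mul wQ trmx0.
have [|||Q' [Q'Q' Q'J Q'Q]] := IH (k + 1)%N (col_mx Q w).
- by rewrite -addnA add1n.
- by rewrite tr_col_mx mul_col_row QQ ww wQ Qw -scalar_mx_block.
- by rewrite mul_col_mx QJ wJ col_mx0.
exists Q'; split=> // i j ij.
by have := Q'Q (lshift 1 i) j ij; rewrite mul_col_mx col_mxEu.
Qed.

(** * Principal vectors of a vector-valued quadratic form *)

Lemma row_free_rowsub (K : fieldType) (m k n : nat) (f : 'I_k -> 'I_m) (A : 'M[K]_(m, n)) :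
  injective f -> row_free A -> row_free (rowsub f A).
Proof.
move=> finj Afree; have -> : rowsub f A = rowsub f 1%:M *m A by rewrite mul_rowsub_mx mul1mx.
apply: inj_row_free => v /eqP; rewrite mulmxA mulmx_free_eq0 // => /eqP v0.
apply/rowP => i; have /rowP/(_ (f i)) := v0; rewrite !mxE (bigD1 i) //= big1 => [|j ji].
  by rewrite !mxE eqxx mulr1 addr0.
by rewrite !mxE (inj_eq finj) (negPf ji) mulr0.
Qed.

Section PrincipalVectors.
Context {R : realType} {n p : nat}.
Variables (J : 'M[R]_(n, n + p)) (B : 'I_(n + p) -> 'M[R]_n).
Hypothesis J_free : row_free J.
Hypothesis B_sym : forall a, (B a)^T = B a.
Hypothesis B_comm : forall a b, B a *m B b = B b *m B a.

(** The quadratic form with values in R^(n+p) whose coordinates have the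
    matrices B a; it stands for the second fundamental form in an isothermal
    chart. *)
Definition vform (X Y : 'rV[R]_n) : 'rV[R]_(n + p) :=
  \row_a dotmul (X *m B a) Y.

Hypothesis vform_normal : forall X Y, vform X Y *m J^T = 0.
Hypothesis gauss : forall X Y Z W : 'rV[R]_n,
  dotmul X Y = 0 -> dotmul X Z = 0 -> dotmul X W = 0 ->
  dotmul Y Z = 0 -> dotmul Y W = 0 -> dotmul Z W = 0 ->
  dotmul (vform X W) (vform Y Z) = dotmul (vform X Z) (vform Y W).

Lemma vformC X Y : vform X Y = vform Y X.
Proof.
by apply/rowP => a; rewrite !mxE dotmul_mulmx B_sym dotmulC.
Qed.

Lemma vformDl X Y Z : vform (X + Y) Z = vform X Z + vform Y Z.
Proof. by apply/rowP => a; rewrite !mxE mulmxDl dotmulDl. Qed.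

Lemma vformZl (c : R) X Z : vform (c *: X) Z = c *: vform X Z.
Proof. by apply/rowP => a; rewrite !mxE -scalemxAl dotmulZl. Qed.

Lemma dotmul_vform X Y (xi : 'rV[R]_(n + p)) :
  dotmul (vform X Y) xi = dotmul (X *m (\sum_a xi 0 a *: B a)) Y.
Proof.
rewrite [LHS]dotmulE mulmx_sumr /dotmul mulmx_suml summxE; apply: eq_bigr => a _.
by rewrite -scalemxAr -scalemxAl [RHS]mxE [vform _ _ 0 a]mxE mulrC.
Qed.

(** When alpha is the second fundamental form in an isothermal chart with
    factor phi, this says that v is in the principal space of phi^-1 eta. *)
Definition principal (v : 'rV[R]_n) (eta : 'rV[R]_(n + p)) :=
  forall Y, vform v Y = dotmul v Y *: eta.

Lemma principalZ (c : R) v eta : principal v eta -> principal (c *: v) eta.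
Proof. by move=> H Y; rewrite vformZl H dotmulZl scalerA. Qed.

Lemma principalD u v eta : principal u eta -> principal v eta -> principal (u + v) eta.
Proof. by move=> H K Y; rewrite vformDl H K dotmulDl scalerDl. Qed.

Lemma principal_orthogonal u v eta zeta : principal u eta -> principal v zeta ->
  eta != zeta -> dotmul u v = 0.
Proof.
move=> Hu Hv ne; apply/eqP; have := Hu v; rewrite vformC Hv dotmulC => /eqP.
by rewrite eq_sym -subr_eq0 -scalerBr scaler_eq0 subr_eq0 (negPf ne) orbF.
Qed.

Lemma principal_normal_is_normal v eta : v != 0 -> principal v eta -> eta *m J^T = 0.
Proof.
move=> v0 H; have := vform_normal v v; rewrite H -scalemxAl => /eqP.
by rewrite scaler_eq0 dotmul_eq0 (negPf v0) => /eqP.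
Qed.

Lemma unit_multiple (v : 'rV[R]_n) : v != 0 -> exists c : R, dotmul (c *: v) (c *: v) = 1.
Proof.
move=> /dotmul_gt0 vv; exists (Num.sqrt (dotmul v v))^-1.
by rewrite dotmulZl dotmulZr mulrA -invfM -expr2 sqr_sqrtr ?ltW // mulVf // gt_eqF.
Qed.

(** With unit vectors, the quadruple e1 + u, e2 + w, e2 - w, e1 - u is pairwise
    orthogonal; alpha takes the values eta - eta1 on the first and the last of
    them, eta - eta2 on the second and the third, and 0 on the first and the
    third. *)
Lemma principal_gauss e1 e2 u w eta eta1 eta2 :
  e1 != 0 -> e2 != 0 -> u != 0 -> w != 0 ->
  principal e1 eta -> principal e2 eta -> principal u eta1 -> principal w eta2 ->
  dotmul e1 e2 = 0 -> dotmul e1 u = 0 -> dotmul e1 w = 0 ->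
  dotmul e2 u = 0 -> dotmul e2 w = 0 -> dotmul u w = 0 ->
  dotmul (eta1 - eta) (eta2 - eta) = 0.
Proof.
move=> /unit_multiple[a E1] /unit_multiple[b E2] /unit_multiple[c Eu] /unit_multiple[d Ew].
move=> /(principalZ a) + /(principalZ b) + /(principalZ c) + /(principalZ d).
set f1 := a *: e1 in E1 *; set f2 := b *: e2 in E2 *.
set s := c *: u in Eu *; set t := d *: w in Ew *.
move=> P1 P2 P3 P4 o12 o1u o1w o2u o2w ouw.
have F12 : dotmul f1 f2 = 0 by rewrite dotmulZl dotmulZr o12 !mulr0.
have F1s : dotmul f1 s = 0 by rewrite dotmulZl dotmulZr o1u !mulr0.
have F1t : dotmul f1 t = 0 by rewrite dotmulZl dotmulZr o1w !mulr0.
have F2s : dotmul f2 s = 0 by rewrite dotmulZl dotmulZr o2u !mulr0.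
have F2t : dotmul f2 t = 0 by rewrite dotmulZl dotmulZr o2w !mulr0.
have Fst : dotmul s t = 0 by rewrite dotmulZl dotmulZr ouw !mulr0.
have Fs1 := etrans (dotmulC s f1) F1s; have Ft1 := etrans (dotmulC t f1) F1t.
have Fs2 := etrans (dotmulC s f2) F2s; have Ft2 := etrans (dotmulC t f2) F2t.
have F21 := etrans (dotmulC f2 f1) F12; have Fts := etrans (dotmulC t s) Fst.
have dB x y z : dotmul x (y - z) = dotmul x y - dotmul x z :> R by rewrite dotmulDr dotmulNr.
have XW : vform (f1 + s) (f1 - s) = eta - eta1.
  by rewrite vformDl P1 P3 !dB E1 Eu F1s Fs1 subr0 sub0r scale1r scaleN1r.
have YZ : vform (f2 + t) (f2 - t) = eta - eta2.
  by rewrite vformDl P2 P4 !dB E2 Ew F2t Ft2 subr0 sub0r scale1r scaleN1r.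
have XZ : vform (f1 + s) (f2 - t) = 0.
  by rewrite vformDl P1 P3 !dB F12 F1t Fs2 Fst subrr !scale0r addr0.
have H : dotmul (eta - eta1) (eta - eta2) = 0.
  rewrite -XW -YZ (gauss (X := f1 + s) (Y := f2 + t) (Z := f2 - t) (W := f1 - s)) ?XZ ?dotmul0l //.
  - by rewrite dotmulDl !dotmulDr F12 F1t Fs2 Fst !addr0.
  - by rewrite dotmulDl !dB F12 F1t Fs2 Fst subrr addr0.
  - by rewrite dotmulDl !dB E1 Eu F1s Fs1 subr0 sub0r subrr.
  - by rewrite dotmulDl !dB E2 Ew F2t Ft2 subr0 sub0r subrr.
  - by rewrite dotmulDl !dB F21 F2s Ft1 Fts subrr addr0.
  - by rewrite dotmulDl dotmulNl !dB F21 F2s Ft1 Fts !subrr.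
by rewrite -[eta1 - _]opprB -[eta2 - _]opprB dotmulNl dotmulNr opprK.
Qed.

(** The vectors u and v need not be orthogonal, but orthogonalizing v against
    u keeps it principal: either eta1 = eta2, or u and v are orthogonal already. *)
Lemma principal_normals_orthogonal u v e1 e2 eta eta1 eta2 :
  e1 != 0 -> e2 != 0 -> dotmul e1 e2 = 0 -> principal e1 eta -> principal e2 eta ->
  (forall c, v != c *: u) -> u != 0 -> principal u eta1 -> principal v eta2 ->
  eta1 != eta -> eta2 != eta -> dotmul (eta1 - eta) (eta2 - eta) = 0.
Proof.
move=> e10 e20 e12 P1 P2 uv u0 P3 P4 ne1 ne2.
pose c := dotmul v u / dotmul u u; pose w := v - c *: u.
have uw : dotmul u w = 0.
  rewrite dotmulDr dotmulNr dotmulZr divfK ?dotmul_eq0 // dotmulC subrr //.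
have w0 : w != 0 by rewrite subr_eq0.
have Pw : principal w eta2.
  have [E|ne] := eqVneq eta1 eta2.
    by rewrite /w -scaleNr; apply: principalD => //; apply: principalZ; rewrite -E.
  have vu : dotmul v u = 0 by rewrite dotmulC (principal_orthogonal P3 P4).
  by rewrite /w /c vu mul0r scale0r subr0.
have ne1' : eta != eta1 by rewrite eq_sym.
have ne2' : eta != eta2 by rewrite eq_sym.
apply: (principal_gauss e10 e20 u0 w0 P1 P2 P3 Pw) => //; exact: principal_orthogonal.
Qed.

Lemma principal_frame : exists2 P : 'M[R]_n, P \in unitmx &
  exists eta : 'I_n -> 'rV[R]_(n + p), forall i, principal (row i P) (eta i).
Proof.
have [A||P Pu HP] := @symmetric_codiagonalizable R n [seq B a | a <- enum 'I_(n + p)].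
- by move=> /mapP[a _ ->]; exact: B_sym.
- by move=> _ _ /mapP[a _ ->] /mapP[b _ ->]; exact: B_comm.
have {}HP a : exists d, P *m B a = diag_mx d *m P.
  by apply: HP; apply: map_f; rewrite mem_enum.
have [d Hd] := choice HP.
exists P => //; exists (fun i => \row_a d a 0 i) => i Y; apply/rowP => a.
by rewrite !mxE -row_mul Hd row_mul row_diag_mx -scalemxAl -rowE dotmulZl mulrC.
Qed.

(** This is where the multiplicity of the given principal normal must be at
    least 2. *)
Lemma principal_orthogonal_pair (E : {vspace 'rV[R]_n}) : (2 <= \dim E)%N ->
  exists e1 e2, [/\ e1 \in E, e2 \in E, e1 != 0, e2 != 0 & dotmul e1 e2 = 0].
Proof.
move=> dE; pose e1 := vpick E.
have e10 : e1 != 0 by rewrite vpick0 -dimv_eq0; case: (\dim E) dE.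
have : ~~ (E <= <[e1]>)%VS.
  by apply: contraL dE => /dimvS; rewrite dim_vline e10 -ltnNge.
move=> /subvPn[x xE xe1].
pose e2 := x - (dotmul e1 x / dotmul e1 e1) *: e1.
exists e1, e2; split=> //; first exact: memv_pick.
- by rewrite rpredB // rpredZ // memv_pick.
- apply: contraNneq xe1 => /eqP; rewrite subr_eq0 => /eqP ->.
  by rewrite rpredZ // memv_line.
- by rewrite dotmulDr dotmulNr dotmulZr divfK ?dotmul_eq0 // subrr.
Qed.

Lemma rank_rows_in_vspace (k : nat) (A : 'M[R]_(k, n)) (E : {vspace 'rV[R]_n}) :
  (forall i, row i A \in E) -> (\rank A <= \dim E)%N.
Proof.
move=> AE; pose M := \matrix_(i < \dim E) ((vbasis E)`_i : 'rV[R]_n).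
apply: leq_trans (rank_leq_row M); apply: mxrankS; apply/row_subP => i.
rewrite (coord_vbasis (AE i)); apply: summx_sub => j _; apply: scalemx_sub.
by rewrite (_ : _`_j = row j M) ?row_sub // rowK.
Qed.

(** The nonzero vectors among the differences nu_i - eta are orthogonal; the
    basis xi starts with their normalizations.  Each xi_j is then orthogonal to
    all differences but at most one, and the remaining n - 1 principal vectors
    are eigenvectors of its shape operator. *)
Theorem principal_normals_quasiumbilical (m : nat) (E : {vspace 'rV[R]_n}) (eta : 'rV[R]_(n + p)) :
  (0 < n)%N -> (2 <= m)%N -> \dim E = m ->
  (forall X, X \in E <-> principal X eta) ->
  (n - m <= p)%N /\ exists xi : 'I_p -> 'rV[R]_(n + p),
  [/\ forall j, xi j *m J^T = 0,
      forall i j, dotmul (xi i) (xi j) = (i == j)%:R &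
      forall j, exists lambda : R,
        (n - 1 <= \rank (eigenspace (\sum_a xi j 0 a *: B a) lambda))%N].
Proof.
move=> n0 m2 dE PE.
have [P Pu [nu Pnu]] := principal_frame.
have Pfree : row_free P by rewrite row_free_unit.
have r0 i : row i P != 0.
  by apply: contraTneq Pfree => r0; rewrite -kermx_eq0; apply/rowV0Pn; exists (delta_mx 0 i);
    [by apply/sub_kermxP; rewrite -rowE|
     by apply/eqP => /rowP /(_ i) /eqP; rewrite !mxE !eqxx oner_eq0].
have [e1 [e2 [/PE P1 /PE P2 e10 e20 e12]]] : exists e1 e2,
    [/\ e1 \in E, e2 \in E, e1 != 0, e2 != 0 & dotmul e1 e2 = 0].
  by apply: principal_orthogonal_pair; rewrite dE.
have eta_n := principal_normal_is_normal e10 P1.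
have nu_n i := principal_normal_is_normal (r0 i) (Pnu i).
have orth i j : i != j -> nu i != eta -> nu j != eta -> dotmul (nu i - eta) (nu j - eta) = 0.
  move=> ij ni nj; apply: (principal_normals_orthogonal e10 e20 e12 P1 P2 _ (r0 i)
    (Pnu i) (Pnu j) ni nj) => c.
  apply/eqP => jc.
  have /eqP : ((delta_mx 0 j : 'rV[R]_n) - c *: delta_mx 0 i) *m P = 0.
    by rewrite mulmxBl -scalemxAl -!rowE jc subrr.
  rewrite mulmx_free_eq0 // => /eqP /rowP /(_ j); rewrite !mxE !eqxx eq_sym (negPf ij).
  by rewrite mulr0 subr0 => /eqP; rewrite oner_eq0.
(* indices of the principal vectors outside of E *)
pose I : {set 'I_n} := [set i | nu i != eta]%SET.
pose q (t : 'I_#|I|) := nu (enum_val t) - eta.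
have q0 t : q t != 0 by rewrite subr_eq0; have := enum_valP t; rewrite inE.
pose Q : 'M[R]_(#|I|, n + p) := \matrix_t ((Num.sqrt (dotmul (q t) (q t)))^-1 *: q t).
have QQ : Q *m Q^T = 1%:M.
  apply/matrixP => s t; rewrite !mxE.
  have -> : \sum_j Q s j * Q^T j t = dotmul (row s Q) (row t Q).
    by rewrite dotmulE; apply: eq_bigr => j _; rewrite !mxE.
  rewrite !rowK dotmulZl dotmulZr; have [->|st] := eqVneq s t.
    by rewrite mulrA -invfM -expr2 sqr_sqrtr ?dotmul_ge0 // mulVf // dotmul_eq0.
  suff -> : dotmul (q s) (q t) = 0 by rewrite !mulr0.
  apply: orth; first by rewrite (inj_eq enum_val_inj).
    by rewrite -subr_eq0 q0.
  by rewrite -subr_eq0 q0.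
have QJ : Q *m J^T = 0.
  apply/row_matrixP => t; rewrite row_mul rowK row0 -scalemxAl mulmxBl nu_n eta_n.
  by rewrite subrr scaler0.
have Ip := orthonormal_size J_free QQ QJ.
have [Q' [Q'Q' Q'J QQ']] := orthonormal_extension J_free QQ QJ.
(* the principal vectors with index outside of I lie in E *)
have dI : (n - m <= #|I|)%N.
  rewrite leq_subLR -{1}[n]card_ord -(cardsC I) addnC leq_add2r -dE.
  have f_inj : injective (enum_val : 'I_#|(~: I)%SET| -> 'I_n) by exact: enum_val_inj.
  have := row_free_rowsub f_inj Pfree; rewrite /row_free => /eqP <-.
  apply: rank_rows_in_vspace => t; rewrite row_rowsub; apply/PE.
  by have := enum_valP t; rewrite !inE negbK => /eqP <-.
split; first exact: leq_trans dI Ip.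
exists (fun j => row j Q'); split.
- by move=> j; rewrite -row_mul Q'J row0.
- move=> i j; have /matrixP/(_ i j) := Q'Q'; rewrite !mxE => <-.
  by rewrite dotmulE; apply: eq_bigr => a _; rewrite !mxE.
move=> j; exists (dotmul eta (row j Q')).
(* for j beyond the normalized differences any index may be left out *)
have [i0 Hi0] : exists i0 : 'I_n, forall i, i != i0 -> dotmul (nu i - eta) (row j Q') = 0.
  have gen (i0 : 'I_n) : (forall t : 'I_#|I|, t = j :> nat -> enum_val t = i0) ->
      forall i, i != i0 -> dotmul (nu i - eta) (row j Q') = 0.
    move=> Ht i ii0; have [->|ni] := eqVneq (nu i) eta; first by rewrite subrr dotmul0l.
    have iI : i \in I by rewrite inE.
    pose t := enum_rank_in iI i.
    have ti : enum_val t = i by rewrite enum_rankK_in.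
    have tj : t != j :> nat by apply: contra_neq ii0 => /Ht; rewrite ti.
    have := QQ' t j tj; rewrite mxE.
    have -> : \sum_a Q t a * Q'^T a j = dotmul (row t Q) (row j Q').
      by rewrite dotmulE; apply: eq_bigr => a _; rewrite !mxE.
    rewrite rowK dotmulZl /q ti => /eqP; rewrite mulf_eq0 invr_eq0 sqrtr_eq0.
    by rewrite leNgt dotmul_gt0 ?subr_eq0 // => /eqP.
  have [jk|kj] := ltnP j #|I|.
    exists (enum_val (Ordinal jk)); apply: gen => t tj.
    by congr enum_val; apply: val_inj.
  exists (Ordinal n0); apply: gen => t tj.
  by have := ltn_ord t; rewrite tj ltnNge kj.
have := row_free_rowsub (@lift_inj _ i0) Pfree; rewrite /row_free => /eqP rk.
rewrite subn1 -{1}rk; apply: mxrankS; apply/row_subP => i; rewrite row_rowsub.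
apply/eigenspaceP; apply: dotmul_inj => Y.
rewrite -dotmul_vform Pnu !dotmulZl mulrC; congr (_ * _).
have := Hi0 (lift i0 i); rewrite eq_sym neq_lift => /(_ isT).
by rewrite dotmulDl dotmulNl => /eqP; rewrite subr_eq0 => /eqP.
Qed.

End PrincipalVectors.

(** * Change of charts *)

Local Notation coord := Defs.coord.

Section Charts.
Context {R : realType} {n : nat} {M : manifold R n}.
Implicit Types (c d : chart R n M) (x : M).

Definition overlap c d := img c `&` param c @^-1` dom d.
Definition transition c d := coord d \o param c.

Lemma overlap_open c d : open (overlap c d).
Proof.
rewrite openE => y [yc yd].
have n1 : nbhs y (img c) by apply: open_nbhs_nbhs; split => //; exact: chart_img_open.
have n2 : nbhs (param c y) (dom d) by apply: open_nbhs_nbhs; split => //; exact: chart_dom_open.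
by apply: filterI => //; exact: (chart_param_cont yc).
Qed.

Arguments overlap_open : clear implicits.

Lemma overlap_coord c d x : chart_at x c -> chart_at x d -> overlap c d (coord c x).
Proof.
by move=> [_ xc] [_ xd]; split; [exact: chart_coord_img|rewrite /= chart_coordK].
Qed.

Lemma transition_coord c d x : chart_at x c -> transition c d (coord c x) = coord d x.
Proof. by move=> [_ xc]; rewrite /transition /= chart_coordK. Qed.

Lemma transition_smooth c d : atlas c -> atlas d -> smooth_on (overlap c d) (transition c d).
Proof. by move=> ac ad; have [] := atlas_compatible ac ad. Qed.

Lemma transition_img c d z : overlap c d z -> img d (transition c d z).
Proof. by move=> [_ zd]; exact: chart_coord_img. Qed.

Lemma near_transition (S : Type) (f : M -> S) c d z : overlap c d z ->
  {near z, f \o param c =1 (f \o param d) \o transition c d}.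
Proof.
move=> O; apply: (near_eq_on (overlap_open c d) O) => w [_ wd].
by rewrite /transition /= (chart_coordK wd).
Qed.

Lemma near_img (S : Type) (h : 'rV[R]_n -> S) c z : img c z ->
  {near z, h \o (coord c \o param c) =1 h}.
Proof.
move=> Uz; apply: (near_eq_on (@chart_img_open R n M c) Uz) => w wc /=.
by rewrite chart_paramK.
Qed.

Section Map.
Context {N : nat}.
Variable (f : M -> 'rV[R]_N).
Hypothesis f_smooth : smooth_map f.

Lemma smooth_chart c : atlas c -> smooth_on (img c) (f \o param c).
Proof. exact: f_smooth. Qed.

Lemma jac_deriveE c x X : chart_at x c -> X *m jac c f x = 'D_X (f \o param c) (coord c x).
Proof.
move=> [ac xc]; apply: esym.
exact: (class_C_deriveE X (@chart_img_open R n M c) (ltn0Sn 0) (smooth_chart ac 1)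
  (chart_coord_img xc)).
Qed.

Lemma jac_coord_deriveE c d x X : chart_at x c -> chart_at x d ->
  X *m jac c (coord d) x = 'D_X (transition c d) (coord c x).
Proof.
move=> xc xd; apply: esym.
exact: (class_C_deriveE X (overlap_open c d) (ltn0Sn 0) (transition_smooth xc.1 xd.1 1)
  (overlap_coord xc xd)).
Qed.

Lemma jac_trans c d x : chart_at x c -> chart_at x d ->
  jac c f x = jac c (coord d) x *m jac d f x.
Proof.
move=> xc xd; apply/row_matrixP => i; rewrite !rowE mulmxA.
have O := overlap_coord xc xd.
rewrite (jac_deriveE _ xc) (jac_deriveE _ xd) (jac_coord_deriveE _ xc xd).
apply: etrans (near_eq_derive _ (near_transition f O)) _.
have [_ E] := derive_chain (overlap_open c d) (@chart_img_open R n M d) (@transition_img c d)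
  (delta_mx 0 i) (transition_smooth xc.1 xd.1 1) (smooth_chart xd.1 1) O.
by apply: etrans E _; rewrite (transition_coord d xc).
Qed.

End Map.

Lemma jac_self c x : chart_at x c -> jac c (coord c) x = 1%:M.
Proof.
move=> xc; apply/row_matrixP => i; rewrite !rowE mulmx1 (jac_coord_deriveE _ xc xc).
have [_ xd] := xc.
apply: etrans (near_eq_derive _ (near_img id (chart_coord_img xd))) _.
exact: derive_id.
Qed.

End Charts.

Arguments overlap_open {R n M} c d.

Section SecondFundamentalForm.
Context {R : realType} {n p : nat} {M : manifold R n}.
Variables (g : riem_metric M) (f : M -> 'rV[R]_(n + p)).
Hypothesis f_iso : isometric_immersion g f.
Implicit Types (c d : chart R n M) (x : M).

Let f_smooth : smooth_map f := f_iso.1.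

Lemma normal_projE c x w : normal_proj f c x w = w *m normal_mx (jac c f x).
Proof. by rewrite /normal_proj /normal_mx mulmxBr mulmx1 !mulmxA. Qed.

Lemma jac_gram c x : chart_at x c -> jac c f x *m (jac c f x)^T = gram g c x.
Proof.
move=> xc; apply/row_matrixP => i; rewrite !rowE; apply: dotmul_inj => w.
rewrite mulmxA dotmul_mulmx trmxK (f_iso.2 x c xc).2 /gdot.
by rewrite /dotmul.
Qed.

Lemma posdef_unit (G : 'M[R]_n) :
  (forall X : 'rV[R]_n, X != 0 -> 0 < (X *m G *m X^T) 0 0) -> G \in unitmx.
Proof.
move=> G0; rewrite -row_free_unit; apply: inj_row_free => v vG.
apply/eqP; apply: contraT => /G0; rewrite vG mul0mx mxE ltxx //.
Qed.

Lemma gram_unit c x : chart_at x c -> gram g c x \in unitmx.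
Proof. by move=> xc; apply: posdef_unit => X X0; exact: gram_posdef. Qed.

Lemma jac_unit c d x : chart_at x c -> chart_at x d -> jac c (coord d) x \in unitmx.
Proof.
move=> xc xd; have := gram_unit xc; rewrite (gram_change g xc xd) !unitmx_mul.
by case/andP => /andP[].
Qed.

Lemma sffE c x X Y : chart_at x c -> sff f c x X Y =
  'D_X ('D_Y (f \o param c)) (coord c x) *m normal_mx (jac c f x).
Proof.
move=> [_ xc]; apply: etrans (normal_projE _ _ _) _.
have E : Defs.deriv c X (Defs.deriv c Y f) x = 'D_X ('D_Y (f \o param c)) (coord c x).
  exact: near_eq_derive (near_img _ (chart_coord_img xc)).
exact: (congr1 (fun w => w *m normal_mx (jac c f x)) E).
Qed.

(** The second derivative of f in the chart c differs from that in d by a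
    tangent vector ([derive_chain2]), and the two charts define the same normal
    projection. *)
Lemma sff_trans c d x X Y : chart_at x c -> chart_at x d ->
  sff f c x X Y = sff f d x (X *m jac c (coord d) x) (Y *m jac c (coord d) x).
Proof.
move=> xc xd; have O := overlap_coord xc xd.
have Tc := transition_smooth xc.1 xd.1.
have Jd : jac d f x *m (jac d f x)^T \in unitmx by rewrite jac_gram // gram_unit.
have PE : normal_mx (jac c f x) = normal_mx (jac d f x).
  by rewrite (jac_trans f_smooth xc xd) normal_mx_unit // jac_unit.
have tangent u : 'D_u (f \o param d) (coord d x) *m normal_mx (jac d f x) = 0.
  by rewrite -(jac_deriveE f_smooth _ xd) -mulmxA (mul_normal_mx Jd) mulmx0.
have E : 'D_X ('D_Y (f \o param c)) (coord c x) =
   'D_X ('D_Y ((f \o param d) \o transition c d)) (coord c x).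
  apply: near_eq_derive; apply: (near_eq_on (overlap_open c d) O) => z Oz.
  exact: near_eq_derive (near_transition f Oz).
have E2 := derive_chain2 (overlap_open c d) (@chart_img_open R n M d) (@transition_img _ _ _ c d)
  X Y (Tc 2) (smooth_chart f_smooth xd.1 2) O.
rewrite (transition_coord d xc) -(jac_coord_deriveE X xc xd) -(jac_coord_deriveE Y xc xd) in E2.
set X' := X *m _ in E2 *; set Y' := Y *m _ in E2 *.
have drop (L A B : 'rV[R]_(n + p)) (P P' : 'M[R]_(n + p)) :
    L = A + B -> A *m P' = 0 -> P = P' -> L *m P = B *m P'.
  by move=> -> A0 ->; rewrite mulmxDl A0 add0r.
have K := drop _ _ _ _ _ (etrans E E2) (tangent _) PE.
exact: etrans (sffE X Y xc) (etrans K (esym (sffE X' Y' xd))).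
Qed.

End SecondFundamentalForm.

(** * The isothermal chart of a conformally flat immersion *)

Section Assembly.
Context {R : realType} {n p : nat} {M : manifold R n}.
Variables (g : riem_metric M) (f : M -> 'rV[R]_(n + p)).
Hypothesis n_gt0 : (0 < n)%N.
Hypothesis f_iso : isometric_immersion g f.
Variable h : chart R n M.
Hypothesis ah : atlas h.

Let f_smooth : smooth_map f := f_iso.1.
Let U := img h.
Let F := f \o param h.
Let oU : open U := @chart_img_open R n M h.
Let F_smooth : smooth_on U F := smooth_chart f_smooth ah.

Lemma chart_at_param y : U y -> chart_at (param h y) h.
Proof. by move=> Uy; split => //; exact: chart_param_dom. Qed.

Let jac_param y : U y -> jac h f (param h y) = 'J F y.
Proof. by move=> Uy; rewrite /jac chart_paramK. Qed.

Lemma normal_connection_chart X (tau : M -> 'rV[R]_(n + p)) (t : 'rV[R]_n -> 'rV[R]_(n + p)) y :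
  U y -> (forall z, U z -> tau (param h z) = t z) ->
  normal_connection f h X tau (param h y) = 'D_X t y *m normal_mx ('J F y).
Proof.
move=> Uy tE; apply: etrans (normal_projE f h _ _) _; rewrite (jac_param Uy).
suff E : Defs.deriv h X tau (param h y) = 'D_X t y by exact: (congr1 (mulmx^~ _) E).
rewrite /Defs.deriv (chart_paramK Uy); apply: near_eq_derive.
exact: (near_eq_on oU Uy tE).
Qed.

Lemma normal_atP y (xi : 'rV[R]_(n + p)) : U y -> xi *m ('J F y)^T = 0 ->
  normal_at f (param h y) xi.
Proof.
move=> Uy xiJ c xc X; rewrite (jac_trans f_smooth xc (chart_at_param Uy)) (jac_param Uy).
by rewrite mulmxA dotmul_mulmx xiJ dotmul0r.
Qed.

(** A normal field given in the chart h extends to a field on M by composition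
    with the coordinates. *)
Lemma flat_in_chart : flat_normal_bundle f ->
  forall s : 'rV[R]_n -> 'rV[R]_(n + p), smooth_on U s ->
    (forall z X, U z -> dotmul ('D_X F z) (s z) = 0) ->
    forall X Y y, U y ->
      'D_X (fun z => 'D_Y s z *m normal_mx ('J F z)) y *m normal_mx ('J F y) =
      'D_Y (fun z => 'D_X s z *m normal_mx ('J F z)) y *m normal_mx ('J F y).
Proof.
move=> flat s s_smooth s_normal X Y y Uy; pose sigma := s \o coord h.
have sE z : U z -> sigma (param h z) = s z by move=> Uz; rewrite /sigma /= chart_paramK.
have sigma_smooth : smooth_in_chart h sigma.
  by move=> k; apply: class_C_ext (s_smooth k) => // z Uz; rewrite /= sE.
have sigma_normal x : dom h x -> normal_at f x (sigma x).
  move=> xh; have Ux := chart_coord_img xh.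
  rewrite -[x](chart_coordK xh); apply: normal_atP => //; rewrite sE //.
  apply: dotmul_inj => X'; rewrite dotmul0l dotmul_mulmx trmxK dotmulC.
  have := s_normal _ X' Ux.
  by rewrite (class_C_deriveE X' oU (ltn0Sn 0) (F_smooth 1) Ux).
have conn V W : normal_connection f h V (normal_connection f h W sigma) (param h y) =
    'D_V (fun z => 'D_W s z *m normal_mx ('J F z)) y *m normal_mx ('J F y).
  apply: normal_connection_chart => // z Uz.
  exact: normal_connection_chart.
have := flat h sigma ah sigma_smooth sigma_normal X Y (param h y) (chart_param_dom Uy).
move=> /subr0_eq H; exact: etrans (esym (conn X Y)) (etrans H (conn Y X)).
Qed.

(** The chart h is conformal, and its own coordinates have the identity as
    Jacobian in h: so the Gram matrix in h is a multiple of the identity. *)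
Lemma conformal_factor : conformal g h -> exists phi : 'rV[R]_n -> R,
  forall y, U y -> [/\ 0 < phi y, gram g h (param h y) = (phi y)%:M &
    forall X Y, dotmul ('D_X F y) ('D_Y F y) = phi y * dotmul X Y].
Proof.
move=> hconf; pose i0 := Ordinal n_gt0.
exists (fun y => gram g h (param h y) i0 i0) => y Uy.
have xh := chart_at_param Uy.
have [l l0 /(_ h xh)] := hconf _ xh.2.
rewrite jac_self // mul1mx trmx1 => E.
have G : gram g h (param h y) = (l^-1)%:M.
  by rewrite -[LHS]scale1r -(mulVf (lt0r_neq0 l0)) -scalerA -E scalemx1.
rewrite G mxE eqxx mulr1n; split => //; first by rewrite invr_gt0.
move=> X Y; have D V := class_C_deriveE V oU (ltn0Sn 0) (F_smooth 1) Uy.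
rewrite !D -(jac_param Uy) (f_iso.2 _ h xh).2 /gdot G mul_mx_scalar -scalemxAl mxE.
by rewrite /dotmul.
Qed.

End Assembly.

Theorem theorem2 (R : realType) (n p m : nat) (M : manifold R n)
    (g : riem_metric M) (f : M -> 'rV[R]_(n + p)) :
  (4 <= n)%N ->
  [set: M] !=set0 ->
  conformally_flat g ->
  isometric_immersion g f ->
  flat_normal_bundle f ->
  proper_immersion g f ->
  (2 <= m)%N ->
  (exists eta : M -> 'rV[R]_(n + p), principal_normal_field g f eta m) ->
  (n - m <= p)%N /\ quasiumbilical g f.
Proof.
move=> n4 [x0 _] cflat f_iso flat _ m2 [eta [_ Peta]].
have n0 : (0 < n)%N by exact: leq_trans n4.
suff pointwise x : (n - m <= p)%N /\ exists xi : 'I_p -> 'rV[R]_(n + p),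
    [/\ forall j, normal_at f x (xi j),
        forall i j, dotmul (xi i) (xi j) = (i == j)%:R &
        forall j c, chart_at x c -> exists2 A, shape_operator g f c x (xi j) A &
          exists lambda : R, (n - 1 <= \rank (eigenspace A lambda))%N].
  by split; [exact: (pointwise x0).1|move=> x; exact: (pointwise x).2].
have [h xh hconf] := cflat x.
have [ah dx] := xh.
pose y := coord h x; pose U := img h; pose F := f \o param h.
have Uy : U y := chart_coord_img dx.
have xE : param h y = x := chart_coordK dx.
have oU : open U := @chart_img_open R n M h.
have F_smooth : smooth_on U F := smooth_chart f_iso.1 ah.
have [phi Hphi] := conformal_factor n0 f_iso ah hconf.
have phi0 z : U z -> 0 < phi z by move=> Uz; have [] := Hphi z Uz.
have F_conf z X Y : U z -> dotmul ('D_X F z) ('D_Y F z) = phi z * dotmul X Y.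
  by move=> Uz; have [_ _ H] := Hphi z Uz; exact: H.
have gramE : gram g h x = (phi y)%:M by have [_ H _] := Hphi y Uy; rewrite -xE.
have gdotE X Y : gdot g h x X Y = phi y * dotmul X Y.
  by rewrite /gdot gramE mul_mx_scalar -scalemxAl mxE.
pose J := jac h f x.
have JE : J = 'J F y by [].
pose e i : 'rV[R]_n := delta_mx 0 i.
pose alpha X Y := sff f h x X Y.
have alphaE X Y : alpha X Y = 'D_X ('D_Y F) y *m normal_mx J by exact: sffE.
have Jfree : row_free J by exact: (f_iso.2 x h xh).1.
have Ju : J *m J^T \in unitmx by rewrite (jac_gram f_iso xh) gram_unit.
pose B a : 'M[R]_n := \matrix_(i, j) alpha (e i) (e j) 0 a.
have vformE X Y : vform B X Y = alpha X Y.
  apply/rowP => a; rewrite mxE.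
  have E : alpha X Y = \sum_i \sum_j (X 0 i * Y 0 j) *: alpha (e i) (e j).
    apply: etrans (alphaE X Y) _.
    apply: etrans (congr1 (mulmx^~ _) (derive2_expand X Y oU (F_smooth 2) Uy)) _.
    rewrite mulmx_suml; apply: eq_bigr => i _; rewrite mulmx_suml; apply: eq_bigr => j _.
    rewrite -scalemxAl; exact: (congr1 _ (esym (alphaE _ _))).
  rewrite E summxE dotmulE.
  transitivity (\sum_j \sum_i X 0 i * B a i j * Y 0 j).
    by apply: eq_bigr => j _; rewrite mxE mulr_suml.
  rewrite exchange_big /=; apply: eq_bigr => i _; rewrite summxE; apply: eq_bigr => j _.
  by rewrite [in LHS]mxE [in RHS]mxE mulrAC.
have alphaC X Y : alpha X Y = alpha Y X.
  apply: etrans (alphaE X Y) (etrans _ (esym (alphaE Y X))).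
  exact: (congr1 (mulmx^~ _) (second_derivative_sym oU F_smooth X Y Uy)).
have B_sym a : (B a)^T = B a by apply/matrixP => i j; rewrite [LHS]mxE [LHS]mxE [RHS]mxE alphaC.
have alphaJ X Y : alpha X Y *m J^T = 0.
  by rewrite alphaE -mulmxA normal_mx_mul // mulmx0.
have ricci X Y xi : \sum_k dotmul xi (alpha Y (e k)) *: alpha X (e k) =
    \sum_k dotmul xi (alpha X (e k)) *: alpha Y (e k).
  have H := isothermal_ricci oU F_smooth phi0 F_conf n0 (flat_in_chart f_iso ah flat) X Y xi Uy.
  have K V W : \sum_k dotmul xi (alpha V (e k)) *: alpha W (e k) =
     \sum_k dotmul xi ('D_V ('D_(e k) F) y *m normal_mx ('J F y)) *:
        ('D_W ('D_(e k) F) y *m normal_mx ('J F y)).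
    apply: eq_bigr => k _.
    exact: (congr2 (fun v w => dotmul xi v *: w) (alphaE V (e k)) (alphaE W (e k))).
  exact: etrans (K Y X) (etrans H (esym (K X Y))).
have B_comm a b : B a *m B b = B b *m B a.
  (* the Ricci equation says that the product of two coordinates is symmetric *)
  have BB_sym : (B a *m B b)^T = B a *m B b.
    apply/matrixP => j i; rewrite mxE.
    have dE w : dotmul (delta_mx 0 a) w = w 0 a :> R.
      by rewrite dotmulC /dotmul trmx_delta -colE mxE.
    have Eij i' j' : (B a *m B b) i' j' =
        (\sum_k dotmul (delta_mx 0 a) (alpha (e i') (e k)) *: alpha (e j') (e k)) 0 b.
      rewrite mxE summxE; apply: eq_bigr => k _.
      by rewrite -{1}(B_sym b) [RHS]mxE dE [B a i' k]mxE [_^T k j']mxE [B b j' k]mxE.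
    apply: etrans (Eij i j) (etrans _ (esym (Eij j i))).
    exact: (congr1 (fun v : 'rV[R]_(n + p) => v 0 b) (ricci (e j) (e i) _)).
  by rewrite -BB_sym trmx_mul !B_sym.
have gauss X Y Z W :
  dotmul X Y = 0 -> dotmul X Z = 0 -> dotmul X W = 0 ->
  dotmul Y Z = 0 -> dotmul Y W = 0 -> dotmul Z W = 0 ->
  dotmul (vform B X W) (vform B Y Z) = dotmul (vform B X Z) (vform B Y W).
  move=> XY XZ XW YZ YW ZW; rewrite !vformE.
  have H := isothermal_gauss oU F_smooth phi0 F_conf Uy XY XZ XW YZ YW ZW.
  apply: etrans (congr2 (@dotmul R _) (alphaE X W) (alphaE Y Z)) _.
  exact: etrans H (esym (congr2 (@dotmul R _) (alphaE X Z) (alphaE Y W))).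
have [_ _ /(_ h xh) [E Espace dE]] := Peta x.
have PE X : X \in E <-> principal B X (phi y *: eta x).
  have -> : X \in E <-> principal_space g f h x (eta x) X by rewrite Espace.
  have scE Y : gdot g h x X Y *: eta x = dotmul X Y *: (phi y *: eta x).
    by rewrite gdotE scalerA mulrC.
  by split=> H Y; have := H Y; rewrite vformE scE.
have vformJ X Y : vform B X Y *m J^T = 0 by rewrite vformE alphaJ.
have [pm [xi [xiJ xiO xiE]]] :=
  principal_normals_quasiumbilical Jfree B_sym B_comm vformJ gauss n0 m2 dE PE.
split => //; exists xi; split => //.
  by move=> j; rewrite -xE; apply: (normal_atP f_iso ah Uy); exact: xiJ.
move=> j c xc; have [lambda rk] := xiE j.
(* the shape operator is Bxi divided by phi in h, and its conjugate by Jc in c *)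
set Bxi := \sum_a _ in rk.
pose Jc := jac c (coord h) x; have Jcu : Jc \in unitmx by exact: (jac_unit g).
exists (Jc *m ((phi y)^-1 *: Bxi) *m invmx Jc).
  move=> X Y; have gdot_c V W : gdot g c x V W = gdot g h x (V *m Jc) (W *m Jc).
    by rewrite /gdot (gram_change g xc xh) trmx_mul !mulmxA.
  rewrite gdot_c gdotE !mulmxA mulmxKV // -scalemxAr dotmulZl mulrA mulfV ?gt_eqF ?phi0 // mul1r.
  by rewrite (sff_trans f_iso X Y xc xh) -/(alpha _ _) -vformE dotmul_vform.
exists ((phi y)^-1 * lambda); apply: leq_trans rk _.
have freeI : row_free (invmx Jc) by rewrite row_free_unit unitmx_inv.
rewrite -(mxrankMfree _ freeI); apply: mxrankS; apply/eigenspaceP.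
rewrite !mulmxA mulmxKV // -scalemxAr; have /eigenspaceP -> := submx_refl (eigenspace Bxi lambda).
by rewrite scalerA -scalemxAl.
Qed.
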